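(* Let $\lambda,\rho\in\mathbb{C}$ with $\Re(\rho)>-\frac12$, $\Re(\rho+\lambda)>-\frac12$ and $\Re(\rho-\lambda)>-\frac12$, let $z\in\mathbb{C}\setminus(-\infty,0]$, and let $r,s\in\mathbb{C}$ with $\min\{\Re(r),\Re(s)\}>0$ and $\Re(\rho\pm\lambda+r)>-\frac12$. Then the double Mellin transform in $(p,q)$ of the $(p,q)$-Whittaker function is $$\int_0^\infty\!\!\int_0^\infty p^{r-1}q^{s-1}M_{p,q;\lambda,\rho}(z)\,dp\,dq=\frac{z^{\rho+\frac12}\exp(-\frac z2)\,\Gamma(r)\,\Gamma(s)\,B(\rho+r-\lambda+\frac12,\rho+s+\lambda+\frac12)}{B(\rho-\lambda+\frac12,\rho+\lambda+\frac12)}\;{}_1F_1\Big(\rho+r-\lambda+\frac12;2\rho+r+s+1;z\Big).$$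
   Context: $B(x,y)=\int_0^1 t^{x-1}(1-t)^{y-1}\,dt=\Gamma(x)\Gamma(y)/\Gamma(x+y)$ is the classical beta function ($\Re x,\Re y>0$), and ${}_1F_1(a;c;z)=\sum_{n\ge0}\frac{(a)_n}{(c)_n}\frac{z^n}{n!}$ is the confluent hypergeometric function, with $(a)_n=a(a+1)\cdots(a+n-1)$, $(a)_0=1$. For real $p,q\ge0$ and $\Re x,\Re y>0$, the extended beta function is $$B_{p,q}(x,y)=\int_0^1 t^{x-1}(1-t)^{y-1}\exp\Big[-\frac pt-\frac q{1-t}\Big]\,dt.$$ The $(p,q)$-confluent hypergeometric function is, for $p,q\ge0$, $\Re(c)>\Re(b)>0$ and $z\in\mathbb{C}$, $$\Phi_{p,q}(b;c;z)=\sum_{n=0}^\infty\frac{B_{p,q}(b+n,c-b)}{B(b,c-b)}\frac{z^n}{n!}.$$ The $(p,q)$-Whittaker function is $$M_{p,q;\lambda,\rho}(z)=z^{\rho+\frac12}\exp\Big(-\frac z2\Big)\,\Phi_{p,q}\Big(\rho-\lambda+\frac12;2\rho+1;z\Big),$$ defined for $p,q\ge0$, $\Re(\rho)>-\frac12$, $\Re(\rho\pm\lambda)>-\frac12$, $z\in\mathbb{C}\setminus(-\infty,0]$, with the principal branch of $z^{\rho+\frac12}$. *)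

(* Defs.v *)
From HB Require Import structures.
From mathcomp Require Import all_boot all_order all_algebra.
From mathcomp Require Import complex.
From mathcomp Require Import all_classical all_reals all_analysis.

Set Implicit Arguments.
Unset Strict Implicit.
Unset Printing Implicit Defensive.

Import Order.TTheory GRing.Theory Num.Theory.
Import numFieldNormedType.Exports.

Local Open Scope classical_set_scope.
Local Open Scope ring_scope.
Local Open Scope complex_scope.

Section ComplexFunctions.
Context {R : realType}.
Implicit Types (t : R) (z a : R[i]).

Definition cexp z : R[i] :=
  (expR (complex.Re z))%:C * (cos (complex.Im z) +i* sin (complex.Im z)).

Definition cabs z : R := complex.Re `|z|.

(* Principal argument, in ]-pi, pi], for z != 0. *)
Definition carg z : R :=
  let theta := acos (complex.Re z / cabs z) in
  if 0 <= complex.Im z then theta else - theta.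

Definition clog z : R[i] := ln (cabs z) +i* carg z.

(* Principal branch of z ^ a, meaningful for z != 0 only. *)
Definition cpow z a : R[i] := cexp (a * clog z).

(* R[i]^o carries the topology of the modulus. *)
Definition cseries (u : nat -> R[i]) : R[i] :=
  lim (series (u : nat -> R[i]^o) @ \oo).

Definition pochhammer a (n : nat) : R[i] := \prod_(k < n) (a + k%:R).

End ComplexFunctions.

Section ComplexIntegral.
Context d (T : measurableType d) (R : realType).
Variables (mu : {measure set T -> \bar R}) (D : set T) (f : T -> R[i]).

Definition cintegrable : Prop :=
  mu.-integrable D (fun x => (complex.Re (f x))%:E) /\
  mu.-integrable D (fun x => (complex.Im (f x))%:E).

Definition cintegral : R[i] :=
  (\int[mu]_(x in D) complex.Re (f x)) +i* (\int[mu]_(x in D) complex.Im (f x)).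

End ComplexIntegral.

Section SpecialFunctions.
Context {R : realType}.
Implicit Types (p q : R) (x y a b c s lambda rho z : R[i]).

Local Notation mu := (@lebesgue_measure R).

Definition cGamma s : R[i] :=
  cintegral mu `]0, +oo[ (fun t => cpow t%:C (s - 1) * (expR (- t))%:C).

Definition cBeta x y : R[i] :=
  cintegral mu `]0, 1[
    (fun t => cpow t%:C (x - 1) * cpow (1 - t)%:C (y - 1)).

Definition extBeta p q x y : R[i] :=
  cintegral mu `]0, 1[
    (fun t => cpow t%:C (x - 1) * cpow (1 - t)%:C (y - 1)
              * (expR (- (p / t) - q / (1 - t)))%:C).

Definition hyp1F1 a c z : R[i] :=
  cseries (fun n => pochhammer a n / pochhammer c n * (z ^+ n / n`!%:R)).

Definition extPhi p q b c z : R[i] :=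
  cseries (fun n => extBeta p q (b + n%:R) (c - b) / cBeta b (c - b)
                    * (z ^+ n / n`!%:R)).

Definition extWhittakerM p q lambda rho z : R[i] :=
  cpow z (rho + 2^-1) * cexp (- (z / 2))
  * extPhi p q (rho - lambda + 2^-1) (2 * rho + 1) z.

End SpecialFunctions.

(* Main.v *)
Require Import Defs.
From mathcomp Require Import all_boot all_order all_algebra.
From mathcomp Require Import complex.
From mathcomp Require Import all_classical all_reals all_analysis.
Import Order.TTheory GRing.Theory Num.Theory.
Import numFieldNormedType.Exports.
Local Open Scope classical_set_scope.
Local Open Scope ring_scope.
Local Open Scope complex_scope.
From HB Require Import structures.
From mathcomp Require Import measurable_realfun ring lra.
Set Implicit Arguments.
Unset Strict Implicit.
Unset Printing Implicit Defensive.

(** Write [b = rho - lambda + 1/2] and [d = rho + lambda + 1/2].  For each [n],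
    Fubini on [(p, q, t)] and the substitution
    [int p^(r-1) e^(-p/t) dp = t^r Gamma(r)] give
    [int int p^(r-1) q^(s-1) B_{p,q}(b+n, d) dp dq
      = Gamma(r) Gamma(s) B(b+r+n, d+s)].
    Since [t^n <= 1] on the unit interval, the modulus of the integrand for [n = 0]
    dominates all of them, so that dominated convergence in
    [(p, q)], with majorant a multiple of [e^|z|], lets one sum over [n] against
    [z^n / n!].  The recursion [(x+y) B(x+1, y) = x B(x, y)] turns
    [B(b+r+n, d+s)] into Pochhammer ratios, i.e. the series of [1F1]. *)

(** * Real and imaginary parts, modulus, exponential and powers of complex numbers *)

Section ComplexBasics.
Context {R : realType}.
Implicit Types (x t : R) (z w a b : R[i]).

(** The beta and gamma kernels may be singular at the endpoints, so each is compared with the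
    derivative of a function with values in [0, 1], such as u / (u + v): by the fundamental theorem
    of calculus its integrals over compact subintervals are at most 1, and Fatou's lemma passes to
    the whole interval. Absolute convergence in (p, q, t) needs no separate estimate: the modulus of
    p^(r-1) e^(-p/t) is the same expression with Re r in place of r, so the exact evaluation at real
    exponents is itself the bound. Convergence of the series 1F1 is not established beforehand
    either: its partial sums, times a constant, are the integrals to which dominated convergence
    applies. *)

Lemma ReD z w : complex.Re (z + w) = complex.Re z + complex.Re w.
Proof. by case: z; case: w. Qed.

Lemma ImD z w : complex.Im (z + w) = complex.Im z + complex.Im w.
Proof. by case: z; case: w. Qed.

Lemma ReB z w : complex.Re (z - w) = complex.Re z - complex.Re w.
Proof. by case: z; case: w. Qed.

Lemma ImB z w : complex.Im (z - w) = complex.Im z - complex.Im w.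
Proof. by case: z; case: w. Qed.

Lemma ReM z w : complex.Re (z * w) =
  complex.Re z * complex.Re w - complex.Im z * complex.Im w.
Proof. by case: z; case: w. Qed.

Lemma ImM z w : complex.Im (z * w) =
  complex.Re z * complex.Im w + complex.Im z * complex.Re w.
Proof. by case: z => ? ?; case: w => ? ? /=. Qed.

Lemma complex_eqP z w :
  complex.Re z = complex.Re w -> complex.Im z = complex.Im w -> z = w.
Proof. by case: z => ? ?; case: w => ? ? /= -> ->. Qed.

Lemma Re_sum I (r : seq I) (P : pred I) (F : I -> R[i]) :
  complex.Re (\sum_(i <- r | P i) F i) = \sum_(i <- r | P i) complex.Re (F i).
Proof. exact: (big_morph (@complex.Re R) ReD). Qed.

Lemma Im_sum I (r : seq I) (P : pred I) (F : I -> R[i]) :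
  complex.Im (\sum_(i <- r | P i) F i) = \sum_(i <- r | P i) complex.Im (F i).
Proof. exact: (big_morph (@complex.Im R) ImD). Qed.

Lemma cabsE z :
  cabs z = Num.sqrt (complex.Re z ^+ 2 + complex.Im z ^+ 2).
Proof. by rewrite /cabs normc_def. Qed.

Lemma normr_cabs z : `|z| = (cabs z)%:C.
Proof. by rewrite /cabs normc_def. Qed.

Lemma cabs_ge0 z : 0 <= cabs z.
Proof. by rewrite cabsE sqrtr_ge0. Qed.

Lemma cabsM z w : cabs (z * w) = cabs z * cabs w.
Proof.
by apply: (@complexI R); rewrite rmorphM /= -!normr_cabs normrM.
Qed.

Lemma cabs_eq0 z : (cabs z == 0) = (z == 0).
Proof. by rewrite -[RHS]normr_eq0 normr_cabs; apply/eqP/eqP => [->|[]]. Qed.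

Lemma cabs0 : cabs (0 : R[i]) = 0.
Proof. by apply/eqP; rewrite cabs_eq0. Qed.

Lemma cabsV z : cabs z^-1 = (cabs z)^-1.
Proof.
have [->|z0] := eqVneq z 0.
  by rewrite !(invr0, cabs0).
apply: (mulfI (x := cabs z)); first by rewrite cabs_eq0.
rewrite -cabsM !divff ?cabs_eq0//.
by rewrite cabsE /= expr1n expr0n addr0 sqrtr1.
Qed.

Lemma cabs_real x : cabs x%:C = `|x|.
Proof. by rewrite cabsE /= expr0n addr0 sqrtr_sqr. Qed.

Lemma cabs_nneg x : 0 <= x -> cabs x%:C = x.
Proof. by move=> x0; rewrite cabs_real ger0_norm. Qed.

Lemma cabsX z n : cabs (z ^+ n) = cabs z ^+ n.
Proof.
elim: n => [|n IH]; first by rewrite !expr0 -[1]/(1%:C) cabs_nneg.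
by rewrite !exprS cabsM IH.
Qed.

Lemma cabs_nat n : cabs (n%:R : R[i]) = n%:R.
Proof. by rewrite -[n%:R in LHS](rmorph_nat (real_complex R)) cabs_nneg. Qed.

Lemma normr_Re_le z : `|complex.Re z| <= cabs z.
Proof.
by rewrite cabsE -sqrtr_sqr ler_wsqrtr// lerDl sqr_ge0.
Qed.

Lemma normr_Im_le z : `|complex.Im z| <= cabs z.
Proof.
by rewrite cabsE -sqrtr_sqr ler_wsqrtr// lerDr sqr_ge0.
Qed.

Lemma cabs_leD z : cabs z <= `|complex.Re z| + `|complex.Im z|.
Proof.
rewrite cabsE -[leRHS]ger0_norm ?addr_ge0// -sqrtr_sqr ler_wsqrtr//.
rewrite sqrrD !real_normK ?num_real// addrAC lerDl.
by rewrite mulrn_wge0// mulr_ge0.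
Qed.

Lemma ler_cabsD z w : cabs (z + w) <= cabs z + cabs w.
Proof. by rewrite -lecR rmorphD/= -!normr_cabs ler_normD. Qed.

Lemma ler_cabs_sum I (r : seq I) (F : I -> R[i]) :
  cabs (\sum_(i <- r) F i) <= \sum_(i <- r) cabs (F i).
Proof.
elim: r => [|i r IH]; first by rewrite !big_nil cabs0.
by rewrite !big_cons (le_trans (ler_cabsD _ _))// lerD2l.
Qed.

Lemma cexpD z w : cexp (z + w) = cexp z * cexp w.
Proof.
rewrite /cexp; case: z => a b; case: w => c d /=.
rewrite expRD cosD sinD; apply: complex_eqP => /=; ring.
Qed.

Lemma cexp0 : cexp (0 : R[i]) = 1.
Proof.
by rewrite /cexp /= expR0 cos0 sin0 mul1r.
Qed.

Lemma cexp_real x : cexp x%:C = (expR x)%:C.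
Proof. by rewrite /cexp /= cos0 sin0 mulr1. Qed.

Lemma cabs_cexp z : cabs (cexp z) = expR (complex.Re z).
Proof.
rewrite /cexp cabsM cabs_nneg ?expR_ge0// cabsE /= cos2Dsin2 sqrtr1.
by rewrite mulr1.
Qed.

(* Total variant of [cpow] on the reals, measurable everywhere. *)
Definition rcpow a t : R[i] := cexp (a * (ln t)%:C).

Lemma cpow_real t a : 0 < t -> cpow t%:C a = rcpow a t.
Proof.
move=> t0; rewrite /cpow /rcpow /clog /carg cabs_nneg ?(ltW t0)//=.
by rewrite lexx divff ?gt_eqF// acos1.
Qed.

(** For t > 0 the right-hand side is the real power t^(Re a); real powers are written in this form
    throughout. *)
Lemma cabs_rcpow a t : cabs (rcpow a t) = expR (complex.Re a * ln t).
Proof. by rewrite /rcpow cabs_cexp ReM /= mulr0 subr0. Qed.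

Lemma rcpowD a b t : rcpow (a + b) t = rcpow a t * rcpow b t.
Proof. by rewrite /rcpow mulrDl cexpD. Qed.

Lemma rcpow0 t : rcpow 0 t = 1.
Proof. by rewrite /rcpow mul0r cexp0. Qed.

Lemma rcpow1 t : 0 < t -> rcpow 1 t = t%:C.
Proof. by move=> t0; rewrite /rcpow mul1r cexp_real lnK. Qed.

Lemma rcpow_nat n t : 0 < t -> rcpow n%:R t = (t ^+ n)%:C.
Proof.
move=> t0; elim: n => [|n IH]; first by rewrite rcpow0 expr0.
by rewrite -natr1 rcpowD IH rcpow1// exprSr rmorphM.
Qed.

Lemma rcpowM a t x : 0 < t -> 0 < x -> rcpow a (t * x) = rcpow a t * rcpow a x.
Proof. by move=> t0 x0; rewrite /rcpow lnM// rmorphD/= mulrDr cexpD. Qed.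

Lemma rcpowS a t : 0 < t -> rcpow a t = t%:C * rcpow (a - 1) t.
Proof. by move=> t0; rewrite -rcpow1// -rcpowD addrC subrK. Qed.

Lemma cvg_complex (u : nat -> R[i]) (l : R[i]) :
  (fun n => complex.Re (u n)) @ \oo --> complex.Re l ->
  (fun n => complex.Im (u n)) @ \oo --> complex.Im l ->
  (u : nat -> R[i]^o) @ \oo --> (l : R[i]^o).
Proof.
move=> hRe hIm; apply/cvgrPdist_lt => e e0.
(* In the order of [R[i]] a positive element is a positive real, so half of its real part can serve
   as tolerance for each component. *)
have [eI eR] : complex.Im e = 0 /\ 0 < complex.Re e.
  by move: e0; rewrite ltcE => /andP[/eqP -> ->].
have e2 : 0 < complex.Re e / 2 by rewrite divr_gt0.
move/cvgrPdist_lt : hRe => /(_ _ e2) hRe.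
move/cvgrPdist_lt : hIm => /(_ _ e2) hIm.
near=> n.
rewrite normr_cabs ltcE /= eI eqxx /=.
rewrite (le_lt_trans (cabs_leD _))// [ltRHS]splitr ReB ImB ltrD//.
  by near: n.
by near: n.
Unshelve. all: by end_near. Qed.

Lemma cseries_lim (u : nat -> R[i]) (l : R[i]) :
  (fun n => complex.Re (\sum_(0 <= k < n) u k)) @ \oo --> complex.Re l ->
  (fun n => complex.Im (\sum_(0 <= k < n) u k)) @ \oo --> complex.Im l ->
  cseries u = l.
Proof.
move=> hRe hIm; apply: (@cvg_lim _ (@norm_hausdorff R[i] (R[i]^o))).
exact: cvg_complex.
Qed.

End ComplexBasics.

(** * Measurability of complex-valued functions *)

Section ComplexMeasurability.
Context d (T : measurableType d) (R : realType) (D : set T).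
Implicit Types (f g : T -> R[i]) (h : T -> R).

Definition cmeasurable f :=
  measurable_fun D (fun x => complex.Re (f x)) /\
  measurable_fun D (fun x => complex.Im (f x)).

Lemma cmeasurable_real h : measurable_fun D h -> cmeasurable (fun x => (h x)%:C).
Proof. by split => //=; exact: measurable_cst. Qed.

Lemma cmeasurable_cst (c : R[i]) : cmeasurable (fun=> c).
Proof. by split; exact: measurable_cst. Qed.

Lemma cmeasurableD f g : cmeasurable f -> cmeasurable g ->
  cmeasurable (fun x => f x + g x).
Proof.
move=> [fr fi] [gr gi]; split.
  under eq_fun do rewrite ReD; exact: measurable_funD.
under eq_fun do rewrite ImD; exact: measurable_funD.
Qed.

Lemma cmeasurableM f g : cmeasurable f -> cmeasurable g ->
  cmeasurable (fun x => f x * g x).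
Proof.
move=> [fr fi] [gr gi]; split.
  under eq_fun do rewrite ReM.
  by apply: measurable_funB; exact: measurable_funM.
under eq_fun do rewrite ImM.
by apply: measurable_funD; exact: measurable_funM.
Qed.

Lemma measurable_cabs f : cmeasurable f -> measurable_fun D (fun x => cabs (f x)).
Proof.
move=> [fr fi]; under eq_fun do rewrite cabsE.
apply: (measurableT_comp (f := @Num.sqrt R)).
  by apply: continuous_measurable_fun => x; exact: sqrt_continuous.
by apply: measurable_funD; exact: measurable_funX.
Qed.

Lemma cmeasurable_cexp f : cmeasurable f -> cmeasurable (fun x => cexp (f x)).
Proof.
move=> [fr fi]; have me : measurable_fun D (fun x => expR (complex.Re (f x))).
  exact: (measurableT_comp (f := @expR R)).
apply: cmeasurableM; first exact: cmeasurable_real.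
split => /=.
  apply: (measurableT_comp (f := @cos R)) fi.
  by apply: continuous_measurable_fun => x; exact: continuous_cos.
apply: (measurableT_comp (f := @sin R)) fi.
by apply: continuous_measurable_fun => x; exact: continuous_sin.
Qed.

Lemma cmeasurable_rcpow a h : measurable_fun D h ->
  cmeasurable (fun x => rcpow a (h x)).
Proof.
move=> mh; apply: cmeasurable_cexp; apply: cmeasurableM.
  exact: cmeasurable_cst.
apply: cmeasurable_real; apply: (measurableT_comp (f := @ln R)) mh.
exact: measurable_ln.
Qed.

End ComplexMeasurability.

(** * Complex integrals, handled through real and imaginary parts *)

Section ComplexIntegration.
Context d (T : measurableType d) (R : realType).
Variables (mu : {measure set T -> \bar R}) (D : set T).
Hypothesis mD : measurable D.
Implicit Types (f g : T -> R[i]) (h : T -> R).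

Lemma cintegrable_measurable f : cintegrable mu D f -> cmeasurable D f.
Proof.
by move=> [/measurable_int/measurable_EFinP ? /measurable_int/measurable_EFinP].
Qed.

Lemma eq_cintegral f g : {in D, f =1 g} -> cintegral mu D f = cintegral mu D g.
Proof.
by move=> fg; rewrite /cintegral; congr (_ +i* _); apply: eq_Rintegral => x xD;
  rewrite fg.
Qed.

Lemma cintegrable_le f h : cmeasurable D f -> mu.-integrable D (EFin \o h) ->
  (forall x, D x -> cabs (f x) <= h x) -> cintegrable mu D f.
Proof.
move=> [mr mi] ih fh; split; apply: le_integrable ih => //;
  try exact/measurable_EFinP; move=> x Dx /=; rewrite lee_fin.
- rewrite (le_trans (normr_Re_le _))// (le_trans (fh _ Dx))//; exact: ler_norm.
- rewrite (le_trans (normr_Im_le _))// (le_trans (fh _ Dx))//; exact: ler_norm.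
Qed.

Lemma eq_cintegrable f g : {in D, f =1 g} -> cintegrable mu D f ->
  cintegrable mu D g.
Proof.
move=> fg [ir ii]; split.
  by apply: (eq_integrable mD _ _ _ ir) => x xD; rewrite fg.
by apply: (eq_integrable mD _ _ _ ii) => x xD; rewrite fg.
Qed.

Lemma cintegrable_cabs f : cintegrable mu D f ->
  mu.-integrable D (fun x => (cabs (f x))%:E).
Proof.
move=> if_; have [ir ii] := if_.
have i2 := integrableD mD (integrable_abse ir) (integrable_abse ii).
apply: le_integrable i2 => //.
  by apply/measurable_EFinP/measurable_cabs/cintegrable_measurable.
move=> x Dx /=; rewrite lee_fin ger0_norm ?cabs_ge0//.
by rewrite (le_trans (cabs_leD _))// ler_norm.
Qed.

(** Each component contributes one copy of the integral of the modulus, hence the factor 2. The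
    sharp constant 1 would bring nothing, as the bound only serves to build a majorant. *)
Lemma cabs_cintegral_le f : cintegrable mu D f ->
  cabs (cintegral mu D f) <= 2 * \int[mu]_(x in D) cabs (f x).
Proof.
move=> if_; have [ir ii] := if_; have ia := cintegrable_cabs if_.
rewrite (le_trans (cabs_leD _))//= mulr_natl mulr2n.
rewrite lerD// (le_trans (le_normr_Rintegral mD _))// le_Rintegral//.
- exact: (integrable_norm ir).
- by move=> x _; exact: normr_Re_le.
- exact: (integrable_norm ii).
- by move=> x _; exact: normr_Im_le.
Qed.

Lemma cintegrableD f g : cintegrable mu D f -> cintegrable mu D g ->
  cintegrable mu D (fun x => f x + g x).
Proof.
move=> [fr fi] [gr gi]; split.
  by under eq_fun do rewrite ReD; exact: (integrableD mD fr gr).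
by under eq_fun do rewrite ImD; exact: (integrableD mD fi gi).
Qed.

Lemma cintegralD f g : cintegrable mu D f -> cintegrable mu D g ->
  cintegral mu D (fun x => f x + g x) = cintegral mu D f + cintegral mu D g.
Proof.
move=> [fr fi] [gr gi]; apply: complex_eqP.
  rewrite ReD /= -RintegralD//; apply: eq_Rintegral => x _; exact: ReD.
rewrite ImD /= -RintegralD//; apply: eq_Rintegral => x _; exact: ImD.
Qed.

Lemma cintegrableZl c f : cintegrable mu D f ->
  cintegrable mu D (fun x => c * f x).
Proof.
move=> if_; have [mfr mfi] := cintegrable_measurable if_.
apply: (cintegrable_le _ (integrableZl mD (cabs c) (cintegrable_cabs if_))).
  by apply: cmeasurableM => //; exact: cmeasurable_cst.
by move=> x _; rewrite cabsM.
Qed.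

Lemma cintegralZl c f : cintegrable mu D f ->
  cintegral mu D (fun x => c * f x) = c * cintegral mu D f.
Proof.
move=> [fr fi].
have Z k h : mu.-integrable D (EFin \o h) ->
    mu.-integrable D (EFin \o (fun x => k * h x)).
  exact: (integrableZl mD k).
apply: complex_eqP.
  rewrite ReM /= -!RintegralZl// -RintegralB//; try exact: Z.
  by apply: eq_Rintegral => x _; rewrite ReM.
rewrite ImM /= -!RintegralZl// -RintegralD//; try exact: Z.
by apply: eq_Rintegral => x _; rewrite ImM.
Qed.

Lemma cintegral0 : cintegral mu D (fun=> 0) = 0.
Proof. by apply: complex_eqP; rewrite /= /Rintegral integral0. Qed.

Lemma cintegrable0 : cintegrable mu D (fun=> 0).
Proof. by split => /=; exact: integrable0. Qed.

Lemma cintegrable_sum I (r : seq I) (F : I -> T -> R[i]) :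
  (forall i, cintegrable mu D (F i)) ->
  cintegrable mu D (fun x => \sum_(i <- r) F i x).
Proof.
move=> iF; elim: r => [|i r IH].
  by under eq_fun do rewrite big_nil; exact: cintegrable0.
by under eq_fun do rewrite big_cons; exact: cintegrableD.
Qed.

Lemma cintegral_sum I (r : seq I) (F : I -> T -> R[i]) :
  (forall i, cintegrable mu D (F i)) ->
  cintegral mu D (fun x => \sum_(i <- r) F i x) =
  \sum_(i <- r) cintegral mu D (F i).
Proof.
move=> iF; elim: r => [|i r IH].
  by under eq_fun do rewrite big_nil; rewrite big_nil cintegral0.
under eq_fun do rewrite big_cons; rewrite big_cons cintegralD ?IH//.
exact: cintegrable_sum.
Qed.

Lemma Rdominated_convergence (f_ : nat -> T -> R) (f h : T -> R) :
  (forall n, measurable_fun D (f_ n)) ->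
  (forall x, D x -> f_ ^~ x @ \oo --> f x) ->
  mu.-integrable D (EFin \o h) ->
  (forall n x, D x -> `|f_ n x| <= h x) ->
  mu.-integrable D (EFin \o f) /\
  (fun n => \int[mu]_(x in D) f_ n x) @ \oo --> \int[mu]_(x in D) f x.
Proof.
move=> mf_ f_f ih f_h.
have mf : measurable_fun D f by exact: measurable_fun_cvg f_f.
have mfE n : measurable_fun D (EFin \o f_ n) by exact/measurable_EFinP.
have fE : {ae mu, forall x, D x -> EFin \o f_ ^~ x @ \oo --> (f x)%:E}.
  by apply: aeW => x Dx; apply: cvg_EFin; [exact: nearW|exact: f_f].
have hE : {ae mu, forall x n, D x -> (`|(f_ n x)%:E| <= (h x)%:E)%E}.
  by apply: aeW => x n Dx; rewrite lee_fin f_h.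
have [if_ _ cf] := dominated_convergence mD mfE
  ((measurable_EFinP D f).2 mf) fE ih hE.
split=> //; apply: fine_cvg.
by rewrite fineK ?(integrable_fin_num mD if_).
Qed.

(** Both components are dominated by the modulus, so the real theorem applies to each with the same
    majorant [h]. *)
Lemma cdominated_convergence (f_ : nat -> T -> R[i]) f h :
  (forall n, cmeasurable D (f_ n)) ->
  (forall x, D x -> (fun n => complex.Re (f_ n x)) @ \oo --> complex.Re (f x)) ->
  (forall x, D x -> (fun n => complex.Im (f_ n x)) @ \oo --> complex.Im (f x)) ->
  mu.-integrable D (EFin \o h) ->
  (forall n x, D x -> cabs (f_ n x) <= h x) ->
  [/\ cintegrable mu D f,
    (fun n => complex.Re (cintegral mu D (f_ n))) @ \oo -->
      complex.Re (cintegral mu D f) &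
    (fun n => complex.Im (cintegral mu D (f_ n))) @ \oo -->
      complex.Im (cintegral mu D f)].
Proof.
move=> mf_ cr ci ih fh.
have [||ir lr] := Rdominated_convergence _ cr ih.
- by move=> n; case: (mf_ n).
- by move=> n x Dx; rewrite (le_trans (normr_Re_le _))// fh.
have [||ii li] := Rdominated_convergence _ ci ih.
- by move=> n; case: (mf_ n).
- by move=> n x Dx; rewrite (le_trans (normr_Im_le _))// fh.
by split.
Qed.

Lemma Re_patch f x :
  complex.Re ((\1_D x)%:C * f x) = ((fun y => complex.Re (f y)) \_ D) x.
Proof.
rewrite indicE patchE ReM /=.
by case: (x \in D); rewrite /= !mul0r subr0 ?mul1r.
Qed.

Lemma Im_patch f x :
  complex.Im ((\1_D x)%:C * f x) = ((fun y => complex.Im (f y)) \_ D) x.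
Proof.
rewrite indicE patchE ImM /=.
by case: (x \in D); rewrite /= !mul0r addr0 ?mul1r.
Qed.

(** Moves the domain into the integrand: the Fubini and scaling lemmas below are stated over the
    whole space. *)
Lemma cintegral_indic f :
  cintegral mu D f = cintegral mu setT (fun x => (\1_D x)%:C * f x).
Proof.
rewrite /cintegral; congr (_ +i* _); rewrite Rintegral_mkcond.
  by apply: eq_Rintegral => x _; rewrite Re_patch.
by apply: eq_Rintegral => x _; rewrite Im_patch.
Qed.

Lemma cintegrable_indic f :
  cintegrable mu D f <-> cintegrable mu setT (fun x => (\1_D x)%:C * f x).
Proof.
have E (h : T -> R) :
    mu.-integrable D (EFin \o h) <-> mu.-integrable setT (EFin \o h \_ D).
  have -> : EFin \o h \_ D = (EFin \o h) \_ D.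
    by apply/funext => x; rewrite /= !patchE; case: ifP.
  exact: integrable_mkcond.
rewrite /cintegrable.
have -> : (fun x => (complex.Re ((\1_D x)%:C * f x))%:E) =
    EFin \o (fun x => complex.Re (f x)) \_ D.
  by apply/funext => x; rewrite Re_patch.
have -> : (fun x => (complex.Im ((\1_D x)%:C * f x))%:E) =
    EFin \o (fun x => complex.Im (f x)) \_ D.
  by apply/funext => x; rewrite Im_patch.
by split=> -[ir ii]; split; apply/E.
Qed.

End ComplexIntegration.

(** An integrable extended-real function is finite almost everywhere, so [fine] alters it on a null
    set only. This turns the inner integrals of Fubini's theorem into real-valued functions. *)
Lemma Rintegral_fine d (T : measurableType d) (R : realType)
    (mu : {measure set T -> \bar R}) (F : T -> \bar R) :
  mu.-integrable setT F ->
  mu.-integrable setT (fun x => (fine (F x))%:E) /\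
  \int[mu]_x fine (F x) = fine (\int[mu]_x F x)%E.
Proof.
move=> iF; have mF := measurable_int _ iF.
have mfF : measurable_fun setT (fun x => (fine (F x))%:E).
  apply/measurable_EFinP; apply: (measurableT_comp (f := fine)) mF.
  exact: fine_measurable.
split.
  apply: le_integrable iF => // x _ /=.
  by case: (F x) => [r||]//=; rewrite normr0 leey.
congr fine; apply: ae_eq_integral => //.
by apply: filterS (integrable_ae measurableT iF) => x + _ => /(_ I) /fineK.
Qed.

(** * Fubini and Tonelli for complex integrands *)

Section ComplexFubini.
Context d1 d2 (T1 : measurableType d1) (T2 : measurableType d2) (R : realType).
Variables (m1 : {sigma_finite_measure set T1 -> \bar R}).
Variables (m2 : {sigma_finite_measure set T2 -> \bar R}).

(** The rectangles [F n] x [G n] exhaust the product because both sequences increase: a point lies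
    in the rectangle at the larger of its two indices. This allows the plane of (p, q) to be one
    factor of a further product. *)
Lemma sigma_finite_prod : sigma_finite setT (m1 \x m2)%E.
Proof.
have /sigma_finiteP[F [TF ndF Ffin]] := sigma_finiteT m1.
have /sigma_finiteP[G [TG ndG Gfin]] := sigma_finiteT m2.
exists (fun n => F n `*` G n).
  apply/esym; rewrite -subTset => -[x y] _.
  have [n _ Fx] : (\bigcup_n F n) x by rewrite -TF.
  have [k _ Gy] : (\bigcup_n G n) y by rewrite -TG.
  exists (maxn n k) => //; split => /=.
    by have /subsetPset := ndF _ _ (leq_maxl n k); apply.
  by have /subsetPset := ndG _ _ (leq_maxr n k); apply.
move=> n; have [mF Foo] := Ffin n; have [mG Goo] := Gfin n.
split; first exact: measurableX.
by rewrite product_measure1E//= lte_mul_pinfty// ge0_fin_numE.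
Qed.

(* The canonical sigma-finite structure on [m1 \x m2], packed by hand because it
   is not inferred. *)
Definition product_sfmeasure : {sigma_finite_measure set (T1 * T2)%type -> \bar R} :=
  HB.pack (m1 \x m2)%E
    (Measure_isSigmaFinite.Build _ _ _
       ((m1 \x m2)%E : {measure set (T1 * T2)%type -> \bar R})
       sigma_finite_prod).

Lemma cfubini1 (f : T1 * T2 -> R[i]) : cintegrable (m1 \x m2)%E setT f ->
  cintegrable m1 setT (fun x => cintegral m2 setT (fun y => f (x, y))) /\
  cintegral m1 setT (fun x => cintegral m2 setT (fun y => f (x, y))) =
  cintegral (m1 \x m2)%E setT f.
Proof.
move=> [ir ii].
have [ir1 er] := Rintegral_fine (integrable_fubini_F ir).
have [ii1 ei] := Rintegral_fine (integrable_fubini_F ii).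
split; first by split.
apply: complex_eqP; rewrite /=.
  by rewrite [LHS]er (integral12_prod_meas1 ir).
by rewrite [LHS]ei (integral12_prod_meas1 ii).
Qed.

(** The modulus of an inner integral is at most the inner integral of the modulus, whose integral is
    finite by Tonelli. *)
Lemma integrable_fubini_G (f : T1 * T2 -> \bar R) :
  (m1 \x m2)%E.-integrable setT f -> m2.-integrable setT (fubini_G m1 f).
Proof.
move=> if_; have mf := measurable_int _ if_.
have maf : measurable_fun setT (fun z => `|f z|%E) by exact: measurableT_comp.
apply/integrableP; split; first exact: (measurable_fubini_G if_).
apply: le_lt_trans ((integrable21ltyP m1 m2 mf).1 if_).
apply: ge0_le_integral => //.
- have mG := measurable_fubini_G if_; exact: measurableT_comp.
- by apply: (measurable_fun_fubini_tonelli_G (abse \o f) maf) => z; exact: abse_ge0.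
- move=> y _; apply: le_abse_integral => //.
  exact/measurableT_comp.
Qed.

Lemma cfubini2 (f : T1 * T2 -> R[i]) : cintegrable (m1 \x m2)%E setT f ->
  cintegrable m2 setT (fun y => cintegral m1 setT (fun x => f (x, y))) /\
  cintegral m2 setT (fun y => cintegral m1 setT (fun x => f (x, y))) =
  cintegral (m1 \x m2)%E setT f.
Proof.
move=> [ir ii].
have [ir1 er] := Rintegral_fine (integrable_fubini_G ir).
have [ii1 ei] := Rintegral_fine (integrable_fubini_G ii).
split; first by split.
apply: complex_eqP; rewrite /=.
  by rewrite [LHS]er (integral21_prod_meas1 ir).
by rewrite [LHS]ei (integral21_prod_meas1 ii).
Qed.

Lemma cintegrable_tonelli1 (f : T1 * T2 -> R[i]) : cmeasurable setT f ->
  (\int[m1]_x \int[m2]_y (cabs (f (x, y)))%:E < +oo)%E ->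
  cintegrable (m1 \x m2)%E setT f.
Proof.
move=> mf foo; have mc := measurable_cabs mf.
apply: (@cintegrable_le _ _ _ _ _ _ f (fun x => cabs (f x))) => //.
apply/(integrable12ltyP m1 m2); first exact/measurable_EFinP.
apply: le_lt_trans foo; rewrite le_eqVlt; apply/orP; left; apply/eqP.
apply: eq_integral => x _; apply: eq_integral => y _ /=.
by rewrite ger0_norm ?cabs_ge0.
Qed.

Lemma cintegrable_tonelli2 (f : T1 * T2 -> R[i]) : cmeasurable setT f ->
  (\int[m2]_y \int[m1]_x (cabs (f (x, y)))%:E < +oo)%E ->
  cintegrable (m1 \x m2)%E setT f.
Proof.
move=> mf foo; apply: cintegrable_tonelli1 => //.
have := @fubini_tonelli _ _ _ _ _ m1 m2 (fun z => (cabs (f z))%:E).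
rewrite /fubini_F /fubini_G => -> //.
  exact/measurable_EFinP/measurable_cabs.
by move=> z; rewrite lee_fin cabs_ge0.
Qed.

(** Tonelli bounds the integral of the modulus by the product of the two integrals of moduli; Fubini
    then pulls each constant out of its integral. *)
Lemma cintegral_prod (f : T1 -> R[i]) (g : T2 -> R[i]) :
  cintegrable m1 setT f -> cintegrable m2 setT g ->
  cintegrable (m1 \x m2)%E setT (fun z => f z.1 * g z.2) /\
  cintegral (m1 \x m2)%E setT (fun z => f z.1 * g z.2) =
  cintegral m1 setT f * cintegral m2 setT g.
Proof.
move=> if_ ig.
have af := integrable_lty measurableT (cintegrable_cabs measurableT if_).
have ag := integrable_fin_num measurableT (cintegrable_cabs measurableT ig).
have [mfr mfi] := cintegrable_measurable if_.
have [mgr mgi] := cintegrable_measurable ig.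
have mc : cmeasurable setT (fun z : T1 * T2 => f z.1 * g z.2).
  apply: cmeasurableM; split.
  - exact: (measurableT_comp mfr measurable_fst).
  - exact: (measurableT_comp mfi measurable_fst).
  - exact: (measurableT_comp mgr measurable_snd).
  - exact: (measurableT_comp mgi measurable_snd).
have ifg : cintegrable (m1 \x m2)%E setT (fun z => f z.1 * g z.2).
  apply: cintegrable_tonelli1 => //=.
  under eq_integral => x _.
    under eq_integral => y _ do rewrite cabsM EFinM.
    rewrite ge0_integralZl//; first over.
    - by apply/measurable_EFinP/measurable_cabs.
    - by move=> y _; rewrite lee_fin cabs_ge0.
    - by rewrite lee_fin cabs_ge0.
  have g0 : (0 <= \int[m2]_y (cabs (g y))%:E)%E.
    by apply: integral_ge0 => y _; rewrite lee_fin cabs_ge0.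
  rewrite /= ge0_integralZr//.
  - by rewrite muleC; apply: lte_mul_pinfty.
  - by apply/measurable_EFinP/measurable_cabs.
  - by move=> y _; rewrite lee_fin cabs_ge0.
split=> //; have [_ <-] := cfubini1 ifg.
under eq_cintegral => x _ do rewrite /= (cintegralZl measurableT (f x) ig) mulrC.
by rewrite (cintegralZl measurableT _ if_) mulrC.
Qed.

End ComplexFubini.

(** * Improper integrals by exhaustion with compact intervals and primitives *)

Section Exhaustion.
Context {R : realType}.
Local Notation mu := (@lebesgue_measure R).
Variables (D : set R) (a b : nat -> R).
Hypothesis mD : measurable D.
Hypothesis abD : forall n x, a n <= x <= b n -> D x.
Hypothesis Dab : forall x, D x -> \forall n \near \oo, a n <= x <= b n.
Hypothesis ab : forall n, a n < b n.
Implicit Types (f F : R -> R).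

Let A n : set R := `[a n, b n].

Let AE n x : A n x <-> a n <= x <= b n.
Proof. by rewrite /A /= in_itv. Qed.

Let DIA n : D `&` A n = A n.
Proof. by apply: setIidr => x /AE; exact: abD. Qed.

Let near_patch f x : D x -> \forall n \near \oo, (f \_ (A n)) x = f x.
Proof.
move=> /Dab; apply: filterS => n /AE Ax; rewrite patchE.
by rewrite (_ : x \in A n)//; exact/mem_set.
Qed.

(** Fatou's lemma for the truncations of [f] to [a n, b n]. They converge pointwise on [D] because
    every point is eventually inside, so the intervals need not be nested. *)
Lemma ge0_integrable_exhaustion f (M : R) : measurable_fun D f ->
  (forall x, D x -> 0 <= f x) ->
  (forall n, (\int[mu]_(x in `[a n, b n]) (f x)%:E <= M%:E)%E) ->
  mu.-integrable D (EFin \o f).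
Proof.
move=> mf f0 fM; apply/integrableP; split; first exact/measurable_EFinP.
pose f_ n := (EFin \o f \_ (A n)).
have f_0 n x : D x -> (0 <= f_ n x)%E.
  by move=> Dx; rewrite /f_ /= lee_fin patchE; case: ifP => // _; exact: f0.
have mf_ n : measurable_fun D (f_ n).
  apply/measurable_EFinP/measurable_restrict => //; first exact: measurable_itv.
  exact: measurable_funS (@subIsetl _ _ _) mf.
have := fatou mu mD mf_ f_0.
rewrite [X in (X <= _)%E](_ : _ = \int[mu]_(x in D) `|(f x)%:E|)%E; last first.
  apply: eq_integral => x /set_mem Dx.
  have cf : f_ ^~ x @ \oo --> (f x)%:E.
    apply: cvg_near_cst; have := near_patch f Dx; apply: filterS => n.
    by rewrite /f_ /= => ->.
  rewrite is_cvg_limn_einfE; last by apply/cvg_ex; exists (f x)%:E.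
  by move/cvg_lim : cf => -> //; rewrite gee0_abs ?lee_fin ?f0.
move=> /le_lt_trans; apply; rewrite limn_einf_lim.
apply: (@le_lt_trans _ _ M%:E); last exact: ltry.
apply: lime_le; first exact: is_cvg_einfs.
apply: nearW => n; apply: (@le_trans _ _ (\int[mu]_(x in D) f_ n x)%E).
  by apply: ereal_inf_lbound; exists n => /=.
apply: le_trans (fM n); rewrite le_eqVlt; apply/orP; left; apply/eqP.
transitivity (\int[mu]_(x in D `&` A n) (f x)%:E)%E; last by rewrite DIA.
rewrite integral_mkcondr; apply: eq_integral => x _; rewrite /f_ /= !patchE.
by case: ifP.
Qed.

(** Dominated convergence for the same truncations, with majorant |f|. *)
Lemma Rintegral_exhaustion_cvg f : mu.-integrable D (EFin \o f) ->
  (fun n => \int[mu]_(x in `[a n, b n]) f x) @ \oo --> \int[mu]_(x in D) f x.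
Proof.
move=> if_; have mf : measurable_fun D f.
  by apply/measurable_EFinP; exact: measurable_int if_.
have mfA n : measurable_fun D (f \_ (A n)).
  apply/measurable_restrict => //; first exact: measurable_itv.
  exact: measurable_funS (@subIsetl _ _ _) mf.
have fA x : D x -> (fun n => (f \_ (A n)) x) @ \oo --> f x.
  by move=> Dx; apply: cvg_near_cst; exact: near_patch.
have fle n x : D x -> `|(f \_ (A n)) x| <= `|f x|.
  by move=> Dx; rewrite patchE; case: ifP => // _; rewrite normr0.
have [_] := @Rdominated_convergence _ _ R mu D mD _ f (fun x => `|f x|) mfA fA
  (integrable_norm if_) fle.
apply: cvg_trans.
apply: near_eq_cvg; apply: nearW => n.
by rewrite -Rintegral_mkcondr DIA.
Qed.

Variables (f F : R -> R).
Hypothesis dF : forall x, D x -> is_derive x 1 F (f x).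
Hypothesis df : forall x, D x -> derivable f x 1.

(** Differentiability of [f] enters only through continuity, which the fundamental theorem asks of
    the integrand. *)
Let FTC n : (\int[mu]_(x in `[a n, b n]) (f x)%:E = (F (b n))%:E - (F (a n))%:E)%E.
Proof.
have D_cont (g : R -> R) (x : R) : derivable g x 1 -> {for x, continuous g}.
  by move=> /derivable1_diffP/differentiable_continuous.
have cF x : D x -> {for x, continuous F}.
  by move=> Dx; apply: D_cont; apply: ex_derive; exact: dF.
apply: continuous_FTC2 => //.
- by apply: continuous_in_subspaceT => x /set_mem /AE /abD/df/D_cont.
- split.
  + move=> x; rewrite in_itv /= => /andP[/ltW ax /ltW xb]; apply: ex_derive.
    by apply: dF; apply: (@abD n); rewrite ax.
  + by apply: cvg_at_right_filter; apply: cF; apply: (@abD n); rewrite lexx ltW.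
  + by apply: cvg_at_left_filter; apply: cF; apply: (@abD n); rewrite lexx ltW.
- move=> x; rewrite in_itv /= => /andP[/ltW ax /ltW xb].
  have Dx : D x by apply: (@abD n); rewrite ax.
  by rewrite derive1E; have := dF Dx => ?; exact: derive_val.
Qed.

Lemma integrable_bounded_primitive :
  (forall x, D x -> 0 <= f x) -> (forall x, D x -> 0 <= F x <= 1) ->
  mu.-integrable D (EFin \o f).
Proof.
move=> f0 F01.
have mf : measurable_fun D f.
  apply: subspace_continuous_measurable_fun => //.
  apply: continuous_in_subspaceT => x /set_mem Dx.
  exact/differentiable_continuous/derivable1_diffP/df.
apply: (@ge0_integrable_exhaustion _ 1) => // n.
have /F01/andP[_ Fb] : D (b n) by apply: (@abD n); rewrite lexx ltW.
have /F01/andP[Fa _] : D (a n) by apply: (@abD n); rewrite lexx ltW.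
by rewrite FTC -EFinB lee_fin; lra.
Qed.

Lemma Rintegral_vanishing_primitive : mu.-integrable D (EFin \o f) ->
  F (a n) @[n --> \oo] --> 0 -> F (b n) @[n --> \oo] --> 0 ->
  \int[mu]_(x in D) f x = 0.
Proof.
move=> if_ Fa Fb; have := Rintegral_exhaustion_cvg if_.
have -> : (fun n => \int[mu]_(x in `[a n, b n]) f x) = (fun n => F (b n) - F (a n)).
  by apply/funext => n; rewrite /Rintegral FTC.
move=> /cvg_lim <- //; rewrite -[RHS](subrr 0); apply/cvg_lim => //.
exact: cvgB.
Qed.

End Exhaustion.

(** * Integrability of the real beta and gamma kernels *)

Section BetaGammaIntegrability.
Context {R : realType}.
Local Notation mu := (@lebesgue_measure R).
Implicit Types (t x : R) (a b : R) (s : R[i]).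

Lemma is_derive_expR_ln a t : 0 < t ->
  is_derive t 1 (fun x => expR (a * ln x)) (expR (a * ln t) * (a / t)).
Proof.
move=> t0; have dl := is_derive1_ln t0.
have da : is_derive t 1 (fun x => a * ln x) (a / t) by apply: is_deriveZ.
exact: (is_derive1_comp (f := @expR R)).
Qed.

Lemma measurable_expR_ln d (T : measurableType d) (D : set T) (g : T -> R) a :
  measurable_fun D g -> measurable_fun D (fun y => expR (a * ln (g y))).
Proof.
move=> mg; apply: (measurableT_comp (f := @expR R)) => //.
apply: measurable_funM; first exact: measurable_cst.
by apply: (measurableT_comp (f := @ln R)) mg; exact: measurable_ln.
Qed.

Lemma measurable_onem (D : set R) : measurable_fun D (fun x : R => 1 - x).
Proof. by apply: measurable_funB; [exact: measurable_cst|exact: measurable_id]. Qed.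

Lemma is_derive_onem t : is_derive t 1 (fun x : R => 1 - x) (-1).
Proof. by rewrite -[-1 in X in is_derive _ _ _ X]sub0r; apply: is_deriveB. Qed.

(* Eta-expanded forms: unifying [f * g] with a lambda is prohibitively slow. *)
Lemma derivable_mul (f g : R -> R) t : derivable f t 1 -> derivable g t 1 ->
  derivable (fun y => f y * g y) t 1.
Proof. exact: derivableM. Qed.

Lemma derivable_add (f g : R -> R) t : derivable f t 1 -> derivable g t 1 ->
  derivable (fun y => f y + g y) t 1.
Proof. exact: derivableD. Qed.

Lemma derivable_inv (f : R -> R) t : f t != 0 -> derivable f t 1 ->
  derivable (fun y => (f y)^-1) t 1.
Proof. exact: derivableV. Qed.

(** The offset 3 makes 1/(n+3) < 1 - 1/(n+3) strict already at n = 0, as the exhaustion requires;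
    offset 2 would give 1/2 on both sides. *)
Lemma near_oo01 t : (0 < t < 1) ->
  \forall n \near \oo, (n.+3%:R^-1 : R) <= t <= 1 - n.+3%:R^-1.
Proof.
move=> /andP[t0 t1].
have h (u : R) : 0 < u -> \forall n \near \oo, (n.+3%:R^-1 : R) <= u.
  move=> u0; near=> n; rewrite -[leRHS]invrK lef_pV2 ?posrE ?invr_gt0//.
  rewrite (@le_trans _ _ n%:R)//; last by rewrite ler_nat -addn3 leq_addr.
  by near: n; exact: nbhs_infty_ger.
have t1' : 0 < 1 - t by rewrite subr_gt0.
apply: filterS2 (h _ t0) (h _ t1') => n h1 h2.
by rewrite h1 lerBrDr addrC -lerBrDr.
Unshelve. all: by end_near. Qed.

Lemma near_0oo t : 0 < t ->
  \forall n \near \oo, (n.+3%:R^-1 : R) <= t <= n.+3%:R.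
Proof.
move=> t0; near=> n; apply/andP; split.
  rewrite -[leRHS]invrK lef_pV2 ?posrE ?invr_gt0//.
  rewrite (@le_trans _ _ n%:R)//; last by rewrite ler_nat -addn3 leq_addr.
  by near: n; exact: nbhs_infty_ger.
rewrite (@le_trans _ _ n%:R)//; last by rewrite ler_nat -addn3 leq_addr.
by near: n; exact: nbhs_infty_ger.
Unshelve. all: by end_near. Qed.

(* The derivative of [u / (u + v)], [u = t^a], [v = (1 - t)^b], dominates a
   multiple of the kernel because [u + v <= 2]. *)
Lemma integrable_beta a b : 0 < a -> 0 < b ->
  mu.-integrable `]0, 1[
    (fun t => (expR ((a - 1) * ln t) * expR ((b - 1) * ln (1 - t)))%:E).
Proof.
move=> a0 b0; pose u t := expR (a * ln t); pose v t := expR (b * ln (1 - t)).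
pose h t := u t * v t * (a / t + b / (1 - t)) / (u t + v t) ^+ 2.
have du t : 0 < t -> is_derive t 1 u (u t * (a / t)) by exact: is_derive_expR_ln.
have dv t : t < 1 -> is_derive t 1 v (v t * (- (b / (1 - t)))).
  move=> t1; have t1' : 0 < 1 - t by rewrite subr_gt0.
  have := is_derive1_comp (g := fun x : R => 1 - x) (is_derive_expR_ln b t1')
    (is_derive_onem t).
  by rewrite mulrN1 -mulrN.
have uv0 t : u t + v t != 0 by rewrite gt_eqF// addr_gt0 ?expR_gt0.
have dF t : (`]0, 1[%classic : set R) t ->
    is_derive t 1 (fun x => u x * (u x + v x)^-1) (h t).
  rewrite /= in_itv /= => /andP[t0 t1].
  have dut := du _ t0; have dvt := dv _ t1.
  have dd : is_derive t 1 (fun x => u x + v x) (u t * (a / t) + v t * (- (b / (1 - t)))).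
    by apply: is_deriveD.
  have dV := is_deriveV (f := fun x => u x + v x) (uv0 t) dd.
  have dM : is_derive t 1 (fun x => u x * (u x + v x)^-1) _ := is_deriveM dut dV.
  apply: is_derive_eq.
  rewrite /GRing.scale /= /h; field.
  by rewrite uv0 !gt_eqF// subr_gt0.
have dh t : (`]0, 1[%classic : set R) t -> derivable h t 1.
  rewrite /= in_itv /= => /andP[t0 t1].
  have dut : derivable u t 1 by have := du _ t0 => ?; exact: ex_derive.
  have dvt : derivable v t 1 by have := dv _ t1 => ?; exact: ex_derive.
  have dt1 : derivable (fun x : R => 1 - x) t 1.
    by have := is_derive_onem t => ?; exact: ex_derive.
  rewrite /h; apply: derivable_mul.
    apply: derivable_mul; first exact: derivable_mul.
    apply: derivable_add; apply: derivable_mul.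
    - exact: derivable_cst.
    - by apply: derivable_inv; [rewrite gt_eqF|exact: derivable_id].
    - exact: derivable_cst.
    - by apply: derivable_inv; [rewrite subr_eq0 gt_eqF|exact: dt1].
  apply: derivable_inv; first by rewrite expf_neq0.
  have dw : derivable (fun y => u y + v y) t 1 by exact: derivable_add.
  by apply: derivable_mul.
have h0 t : (`]0, 1[%classic : set R) t -> 0 <= h t.
  rewrite /= in_itv /= => /andP[t0 t1].
  rewrite /h divr_ge0 ?exprn_ge0 ?addr_ge0 ?expR_ge0// !mulr_ge0 ?expR_ge0//.
  by rewrite addr_ge0// divr_ge0 ?subr_ge0// ltW.
have F01 t : (`]0, 1[%classic : set R) t -> 0 <= u t * (u t + v t)^-1 <= 1.
  move=> _; rewrite mulr_ge0 ?invr_ge0 ?addr_ge0 ?expR_ge0//=.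
  by rewrite ler_pdivrMr ?addr_gt0 ?expR_gt0// mul1r lerDl expR_ge0.
have ih : mu.-integrable `]0, 1[ (EFin \o h).
  apply: (@integrable_bounded_primitive _ _ (fun n => n.+3%:R^-1)
    (fun n => 1 - n.+3%:R^-1) _ _ _ _ h _ dF dh h0 F01).
  - exact: measurable_itv.
  - move=> n x /andP[nx xn]; rewrite /= in_itv /=.
    by rewrite (lt_le_trans _ nx) ?invr_gt0// (le_lt_trans xn)// ltrBlDr ltrDl invr_gt0.
  - by move=> x; rewrite /= in_itv /=; exact: near_oo01.
  - move=> n; rewrite ltrBrDr -mulr2n -[_ *+ 2]mulr_natl.
    by rewrite ltr_pdivrMr// mul1r ltr_nat.
(* On the interval, [h t] is the kernel times (a (1-t) + b t) / (u + v)^2. The numerator is a convex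
   combination of [a] and [b], hence at least their minimum, and the denominator is at most 4; this
   gives the constant 4 / min(a, b). *)
have m0 : 0 < Num.min a b by rewrite lt_min a0.
have ik := @integrableZl _ _ R mu _ (measurable_itv _) (4 / Num.min a b) _ ih.
apply: (@le_integrable _ _ R mu _ (measurable_itv _) _ _ _ _ ik).
  apply/measurable_EFinP/measurable_funM; apply: measurable_expR_ln.
    exact: measurable_id.
  exact: measurable_onem.
move=> t; rewrite /= in_itv /= => /andP[t0 t1].
have t1' : 0 < 1 - t by rewrite subr_gt0.
rewrite lee_fin ger0_norm ?mulr_ge0 ?expR_ge0//.
apply: le_trans (ler_norm _).
have -> : expR ((a - 1) * ln t) * expR ((b - 1) * ln (1 - t)) =
    u t * v t / (t * (1 - t)).
  rewrite !mulrBl !mul1r !expRB !lnK// /u /v.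
  by rewrite invfM mulrACA.
have u1 : u t <= 1.
  by rewrite -expR0 ler_expR mulr_ge0_le0 ?ltW// ln_lt0// t0.
have v1 : v t <= 1.
  by rewrite -expR0 ler_expR mulr_ge0_le0 ?ltW// ln_lt0// t1' ltrBlDr ltrDl.
have u0 : 0 < u t by exact: expR_gt0.
have v0 : 0 < v t by exact: expR_gt0.
have w0 : 0 < (u t + v t) ^+ 2 by rewrite exprn_gt0// addr_gt0.
have w4 : (u t + v t) ^+ 2 <= 4 by rewrite expr2; nra.
have hm : Num.min a b <= a * (1 - t) + b * t.
  have ma : Num.min a b <= a by rewrite ge_min lexx.
  have mb : Num.min a b <= b by rewrite ge_min lexx orbT.
  nra.
have -> : h t = u t * v t / (t * (1 - t)) *
    ((a * (1 - t) + b * t) / (u t + v t) ^+ 2).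
  rewrite /h; field.
  by rewrite uv0 !gt_eqF// subr_gt0.
rewrite mulrCA ler_peMr//; first by rewrite divr_ge0 ?mulr_ge0// ltW.
have mw0 : 0 < Num.min a b * (u t + v t) ^+ 2 by exact: mulr_gt0.
rewrite mulrACA -invfM ler_pdivlMr// mul1r mulrC.
by apply: ler_pM => //; exact: ltW.
Qed.

(* [ln (t / 2a) < t / 2a], so that [t^a] is at most a multiple of [e^(t/2)]. *)
Lemma expR_ln_le a t : 0 < a -> 0 < t ->
  expR (a * ln t) <= expR (a * ln (2 * a)) * expR (t / 2).
Proof.
move=> a0 t0; have a20 : 0 < 2 * a by rewrite mulr_gt0.
rewrite -expRD ler_expR.
have /ltW := ln_sublinear (divr_gt0 t0 a20).
rewrite ln_div// lerBlDr => /(ler_wpM2l (ltW a0)) /le_trans; apply.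
rewrite mulrDr addrC lerD2l le_eqVlt; apply/orP; left; apply/eqP.
by field; rewrite gt_eqF.
Qed.

(** The comparison function [h] is the derivative of u / (u + 1) with u = t^a. It behaves like a
    t^(a-1) near 0 and like a t^(-a-1) at infinity, which the exponential decay of the kernel
    beats. *)
Lemma integrable_gamma a : 0 < a ->
  mu.-integrable `]0, +oo[
    (fun t => (expR ((a - 1) * ln t) * expR (- t))%:E).
Proof.
move=> a0; pose u t := expR (a * ln t).
pose h t := u t * (a / t) / (u t + 1) ^+ 2.
have du t : 0 < t -> is_derive t 1 u (u t * (a / t)) by exact: is_derive_expR_ln.
have uv0 t : u t + 1 != 0 by rewrite gt_eqF// addr_gt0 ?expR_gt0.
have dF t : (`]0, +oo[%classic : set R) t ->
    is_derive t 1 (fun x => u x * (u x + 1)^-1) (h t).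
  rewrite /= in_itv /= andbT => t0; have dut := du _ t0.
  have dd : is_derive t 1 (fun x => u x + 1) (u t * (a / t) + 0).
    by apply: is_deriveD.
  have dV := is_deriveV (f := fun x => u x + 1) (uv0 t) dd.
  have dM : is_derive t 1 (fun x => u x * (u x + 1)^-1) _ := is_deriveM dut dV.
  apply: is_derive_eq.
  by rewrite /GRing.scale /= /h; field; rewrite uv0 gt_eqF.
have dh t : (`]0, +oo[%classic : set R) t -> derivable h t 1.
  rewrite /= in_itv /= andbT => t0.
  have dut : derivable u t 1 by have := du _ t0 => ?; exact: ex_derive.
  rewrite /h; apply: derivable_mul.
    apply: derivable_mul; first exact: dut.
    apply: derivable_mul; first exact: derivable_cst.
    by apply: derivable_inv; [rewrite gt_eqF|exact: derivable_id].
  apply: derivable_inv; first by rewrite expf_neq0.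
  have dw : derivable (fun y => u y + 1) t 1.
    by apply: derivable_add; [exact: dut|exact: derivable_cst].
  by apply: derivable_mul.
have h0 t : (`]0, +oo[%classic : set R) t -> 0 <= h t.
  rewrite /= in_itv /= andbT => t0.
  by rewrite /h divr_ge0 ?exprn_ge0 ?addr_ge0 ?mulr_ge0 ?expR_ge0 ?invr_ge0// ltW.
have F01 t : (`]0, +oo[%classic : set R) t -> 0 <= u t * (u t + 1)^-1 <= 1.
  move=> _; rewrite mulr_ge0 ?invr_ge0 ?addr_ge0 ?expR_ge0//=.
  by rewrite ler_pdivrMr ?addr_gt0 ?expR_gt0// mul1r lerDl.
have ih : mu.-integrable `]0, +oo[ (EFin \o h).
  apply: (@integrable_bounded_primitive _ _ (fun n => n.+3%:R^-1)
    (fun n => n.+3%:R) _ _ _ _ h _ dF dh h0 F01).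
  - exact: measurable_itv.
  - move=> n x /andP[nx xn]; rewrite /= in_itv /= andbT.
    by rewrite (lt_le_trans _ nx) ?invr_gt0.
  - by move=> x; rewrite /= in_itv /= andbT; exact: near_0oo.
  - move=> n; rewrite (@lt_trans _ _ 1) ?ltr1n//.
    by rewrite invf_lt1 ?ltr1n.
(* The domination reduces to (u + 1)^2 <= K e^t. It is the square of u + 1 <= (C + 1) e^(t/2), where
   u <= C e^(t/2) is [expR_ln_le] with C = (2a)^a, and 1 <= e^(t/2). *)
pose K := (expR (a * ln (2 * a)) + 1) ^+ 2.
have K0 : 0 <= K by rewrite exprn_ge0// addr_ge0 ?expR_ge0.
have ik := @integrableZl _ _ R mu _ (measurable_itv _) (K / a) _ ih.
apply: (@le_integrable _ _ R mu _ (measurable_itv _) _ _ _ _ ik).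
  apply/measurable_EFinP/measurable_funM.
    by apply: measurable_expR_ln; exact: measurable_id.
  by apply: (measurableT_comp (f := @expR R)).
move=> t; rewrite /= in_itv /= andbT => t0.
rewrite lee_fin ger0_norm ?mulr_ge0 ?expR_ge0//.
apply: le_trans (ler_norm _).
have u0 : 0 < u t by exact: expR_gt0.
have -> : expR ((a - 1) * ln t) = u t / t.
  by rewrite mulrBl mul1r expRB lnK.
have -> : K / a * h t = u t / t * (K / (u t + 1) ^+ 2).
  by rewrite /h; field; rewrite uv0 !gt_eqF.
apply: ler_wpM2l; first by rewrite divr_ge0// ltW.
rewrite ler_pdivlMr ?exprn_gt0 ?addr_gt0// mulrC expRN ler_pdivrMr ?expR_gt0//.
have -> : expR t = expR (t / 2) ^+ 2 by rewrite expr2 -expRD -splitr.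
rewrite /K -exprMn lerXn2r ?nnegrE ?mulr_ge0 ?addr_ge0 ?expR_ge0//.
rewrite mulrDl mul1r lerD ?expR_ln_le//.
by rewrite -expR0 ler_expR divr_ge0 // ltW.
Qed.

End BetaGammaIntegrability.

(** * The linear substitution x -> x / t *)

Section Scaling.
Context {R : realType}.
Local Notation mu := (@lebesgue_measure R).

(** Lebesgue measure equals 1/t times its image under x -> x / t: both agree on half-open intervals,
    and uniqueness extends this to measurable sets. The integral against the image measure is then
    the substituted one. *)
Lemma ge0_integral_scale (t : R) (f : R -> \bar R) : 0 < t ->
  measurable_fun setT f -> (forall x, (0 <= f x)%E) ->
  integral mu setT (fun x : R => f (x / t)) = (t%:E * integral mu setT f)%E.
Proof.
move=> t0 mf f0.
pose phi (x : measurableTypeR R) : measurableTypeR R := x / t.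
have mphi : measurable_fun setT phi.
  by apply: measurable_funM => //; exact: measurable_cst.
have ti0 : 0 <= t^-1 by rewrite invr_ge0 ltW.
pose m : {measure set (measurableTypeR R) -> \bar R} :=
  mscale (NngNum ti0) (pushforward mu phi).
have mE A : measurable A -> mu A = m mphi A.
  apply: lebesgue_measure_unique => X [[x y] _ <-].
  rewrite /m /= /mscale /= /pushforward.
  have -> : (phi @^-1` `]x, y]%classic) = `]x * t, y * t]%classic.
    by apply/seteqP; split => z; rewrite /= !in_itv /= ltr_pdivlMr// ler_pdivrMr.
  rewrite !lebesgue_measure_itv /= !lte_fin ltr_pM2r//.
  case: ifP => _; last by rewrite mule0.
  rewrite -!EFinB -EFinM; congr EFin; field; exact: lt0r_neq0.
have e : (\int[mu]_x f x = \int[m mphi]_x f x)%E.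
  apply: eq_measure_integral => A mA _; exact: mE.
rewrite e /m ge0_integral_mscale//= ge0_integral_pushforward//.
by rewrite muleA -EFinM divff ?gt_eqF// mul1e.
Qed.

Lemma integrable_scale (t : R) (f : R -> R) : 0 < t ->
  mu.-integrable setT (EFin \o f) ->
  mu.-integrable setT (fun x : R => (f (x / t))%:E) /\
  Rintegral mu setT (fun x : R => f (x / t)) = t * Rintegral mu setT f.
Proof.
move=> t0 if_; have mf := measurable_int _ if_.
have mt : measurable_fun setT (fun x : R => x / t).
  by apply: measurable_funM => //; exact: measurable_cst.
have mft : measurable_fun setT (fun x : R => (f (x / t))%:E).
  exact: (measurableT_comp (f := EFin \o f) mf mt).
have ift : mu.-integrable setT (fun x : R => (f (x / t))%:E).
  apply/integrableP; split=> //.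
  rewrite (@ge0_integral_scale t (fun x => `|(f x)%:E|%E)) //.
    by apply: lte_mul_pinfty => //; [exact: ltW|exact/integrable_lty/integrable_abse].
  exact: measurableT_comp.
split=> //; rewrite /Rintegral.
rewrite [X in fine X]integralE [in RHS]integralE.
have mp := measurable_funepos mf; have mn := measurable_funeneg mf.
have -> : integral mu setT ((fun x : R => (f (x / t))%:E)^\+)%E =
    (t%:E * integral mu setT (EFin \o f)^\+)%E.
  rewrite -(@ge0_integral_scale t ((EFin \o f)^\+)%E t0 mp (funepos_ge0 _)).
  by apply: eq_integral => x _; rewrite !funeposE.
have -> : integral mu setT ((fun x : R => (f (x / t))%:E)^\-)%E =
    (t%:E * integral mu setT (EFin \o f)^\-)%E.
  rewrite -(@ge0_integral_scale t ((EFin \o f)^\-)%E t0 mn (funeneg_ge0 _)).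
  by apply: eq_integral => x _; rewrite !funenegE.
have fp := integrable_pos_fin_num measurableT if_.
have fn := integrable_neg_fin_num measurableT if_.
by rewrite -(fineK fp) -(fineK fn) -!EFinM -!EFinB /= mulrBr.
Qed.

Lemma cintegral_scale (t : R) (f : R -> R[i]) : 0 < t ->
  cintegrable mu setT f ->
  cintegrable mu setT (fun x : R => f (x / t)) /\
  cintegral mu setT (fun x : R => f (x / t)) = t%:C * cintegral mu setT f.
Proof.
move=> t0 [ir ii].
have [ir1 er] := integrable_scale t0 ir.
have [ii1 ei] := integrable_scale t0 ii.
split; first by split.
apply: complex_eqP; rewrite (ReM, ImM) /= mul0r ?subr0 ?addr0.
  exact: er.
exact: ei.
Qed.

End Scaling.

(** * Complex beta and gamma integrals, and the beta recursion *)

Section BetaGamma.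
Context {R : realType}.
Local Notation mu := (@lebesgue_measure R).
Implicit Types (t : R) (a s x y : R[i]).

Definition gamma_kernel s t : R[i] := rcpow (s - 1) t * (expR (- t))%:C.

Definition beta_kernel x y t : R[i] := rcpow (x - 1) t * rcpow (y - 1) (1 - t).

Lemma cGammaE s : cGamma s = cintegral mu `]0, +oo[ (gamma_kernel s).
Proof.
apply: eq_cintegral => t /set_mem; rewrite /= in_itv /= andbT => t0.
by rewrite cpow_real.
Qed.

Lemma cBetaE x y : cBeta x y = cintegral mu `]0, 1[ (beta_kernel x y).
Proof.
apply: eq_cintegral => t /set_mem; rewrite /= in_itv /= => /andP[t0 t1].
by rewrite !cpow_real// subr_gt0.
Qed.

Lemma cmeasurable_beta_kernel D x y : cmeasurable D (beta_kernel x y).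
Proof.
apply: cmeasurableM; apply: cmeasurable_rcpow; first exact: measurable_id.
exact: measurable_onem.
Qed.

Lemma cintegrable_gamma_kernel s : 0 < complex.Re s ->
  cintegrable mu `]0, +oo[ (gamma_kernel s).
Proof.
move=> s0.
apply: (@cintegrable_le _ _ R mu _ (measurable_itv _) _ _ _ (integrable_gamma s0)).
  apply: cmeasurableM; first by apply: cmeasurable_rcpow; exact: measurable_id.
  by apply: cmeasurable_real; apply: (measurableT_comp (f := @expR R)).
move=> t _; rewrite /gamma_kernel cabsM cabs_rcpow cabs_nneg ?expR_ge0//.
by rewrite ReB.
Qed.

Lemma cintegrable_beta_kernel x y : 0 < complex.Re x -> 0 < complex.Re y ->
  cintegrable mu `]0, 1[ (beta_kernel x y).
Proof.
move=> x0 y0.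
apply: (@cintegrable_le _ _ R mu _ (measurable_itv _) _ _ _ (integrable_beta x0 y0)).
  exact: cmeasurable_beta_kernel.
by move=> t _; rewrite cabsM !cabs_rcpow !ReB.
Qed.

(** Writing p = t (p/t) splits off t^(s-1) by multiplicativity of the power; the remaining factor t
    is the Jacobian. *)
Lemma cGamma_scale t s : 0 < t -> 0 < complex.Re s ->
  let f p : R[i] := (\1_(`]0, +oo[%classic : set R) p)%:C *
    (rcpow (s - 1) p * (expR (- (p / t)))%:C) in
  cintegrable mu setT f /\ cintegral mu setT f = rcpow s t * cGamma s.
Proof.
move=> t0 s0 f; have ik := cintegrable_gamma_kernel s0.
have [ig eg] := cintegral_scale t0
  ((cintegrable_indic mu (measurable_itv _) _).1 ik).
have fE : f = (fun p => rcpow (s - 1) t *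
    ((\1_(`]0, +oo[%classic : set R) (p / t))%:C * gamma_kernel s (p / t))).
  apply/funext => p; rewrite /f !indicE !mem_setE !in_itv /= !andbT.
  rewrite pmulr_lgt0 ?invr_gt0//; case: ltP => p0; last first.
    by rewrite !mul0r mulr0.
  rewrite !mul1r /gamma_kernel mulrA -rcpowM ?divr_gt0//.
  by rewrite mulrCA divff ?gt_eqF// mulr1.
rewrite fE; split; first exact: (cintegrableZl (mu := mu) measurableT _ ig).
rewrite (cintegralZl (mu := mu) measurableT _ ig) eg mulrA [_ * t%:C]mulrC.
by rewrite -rcpowS// cGammaE [in RHS](cintegral_indic mu).
Qed.

(** Componentwise derivative in a real variable, so that the real lemmas on primitives apply to each
    component. *)
Definition is_cderive (f : R -> R[i]) t (df : R[i]) :=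
  is_derive t 1 (fun u => complex.Re (f u)) (complex.Re df) /\
  is_derive t 1 (fun u => complex.Im (f u)) (complex.Im df).

Lemma is_cderiveM f g t df dg : is_cderive f t df -> is_cderive g t dg ->
  is_cderive (fun u => f u * g u) t (df * g t + f t * dg).
Proof.
move=> [fr fi] [gr gi]; split.
  have h1 : is_derive t 1 (fun u => complex.Re (f u) * complex.Re (g u)) _ :=
    is_deriveM fr gr.
  have h2 : is_derive t 1 (fun u => complex.Im (f u) * complex.Im (g u)) _ :=
    is_deriveM fi gi.
  have h3 : is_derive t 1 (fun u => complex.Re (f u) * complex.Re (g u) -
    complex.Im (f u) * complex.Im (g u)) _ := is_deriveB h1 h2.
  under eq_fun do rewrite ReM.
  apply: is_derive_eq; rewrite ReD !ReM /GRing.scale /=; ring.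
have h1 : is_derive t 1 (fun u => complex.Re (f u) * complex.Im (g u)) _ :=
  is_deriveM fr gi.
have h2 : is_derive t 1 (fun u => complex.Im (f u) * complex.Re (g u)) _ :=
  is_deriveM fi gr.
have h3 : is_derive t 1 (fun u => complex.Re (f u) * complex.Im (g u) +
  complex.Im (f u) * complex.Re (g u)) _ := is_deriveD h1 h2.
under eq_fun do rewrite ImM.
apply: is_derive_eq; rewrite ImD !ImM /GRing.scale /=; ring.
Qed.

Lemma is_cderiveD f g t df dg : is_cderive f t df -> is_cderive g t dg ->
  is_cderive (fun u => f u + g u) t (df + dg).
Proof.
move=> [fr fi] [gr gi]; split.
  under eq_fun do rewrite ReD.
  by rewrite ReD; exact: (is_deriveD fr gr).
under eq_fun do rewrite ImD.
by rewrite ImD; exact: (is_deriveD fi gi).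
Qed.

Lemma is_cderive_cst (c : R[i]) t : is_cderive (fun=> c) t 0.
Proof. by split; exact: is_derive_cst. Qed.

Lemma is_cderive_onem f t df : is_cderive f (1 - t) df ->
  is_cderive (fun u => f (1 - u)) t (- df).
Proof.
move=> [fr fi]; split.
  have := is_derive1_comp (g := fun u : R => 1 - u) fr (is_derive_onem t).
  by rewrite mulrN1; case: df {fr fi}.
have := is_derive1_comp (g := fun u : R => 1 - u) fi (is_derive_onem t).
by rewrite mulrN1; case: df {fr fi}.
Qed.

Lemma is_cderive_rcpow a t : 0 < t ->
  is_cderive (rcpow a) t (a * rcpow (a - 1) t).
Proof.
move=> t0; have dl := is_derive1_ln t0.
have dE := is_derive_expR_ln (complex.Re a) t0.
have dI : is_derive t 1 (fun u => complex.Im a * ln u) (complex.Im a / t).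
  by apply: is_deriveZ.
have dC := is_derive1_comp (g := fun u => complex.Im a * ln u)
  (is_derive_cos (complex.Im a * ln t)) dI.
have dS := is_derive1_comp (g := fun u => complex.Im a * ln u)
  (is_derive_sin (complex.Im a * ln t)) dI.
have ReE u : complex.Re (rcpow a u) =
    expR (complex.Re a * ln u) * cos (complex.Im a * ln u).
  rewrite /rcpow /cexp (ReM a) (ImM a) (ReM (expR _)%:C) /= !mulr0 !mul0r.
  by rewrite subr0 add0r subr0.
have ImE u : complex.Im (rcpow a u) =
    expR (complex.Re a * ln u) * sin (complex.Im a * ln u).
  rewrite /rcpow /cexp (ReM a) (ImM a) (ImM (expR _)%:C) /= !mulr0 !mul0r.
  by rewrite subr0 add0r addr0.
have aE : rcpow (a - 1) t = (t^-1)%:C * rcpow a t.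
  rewrite [rcpow a t](@rcpowS _ a t)// mulrA -rmorphM /=.
  by rewrite mulVf ?gt_eqF// mul1r.
split.
  under eq_fun do rewrite ReE.
  have dM : is_derive t 1
    (fun u => expR (complex.Re a * ln u) * cos (complex.Im a * ln u)) _ :=
    is_deriveM dE dC.
  apply: is_derive_eq; rewrite aE ReM (ReM _ (rcpow a t)) (ImM _ (rcpow a t)).
  by rewrite ReE ImE /GRing.scale /=; ring.
under eq_fun do rewrite ImE.
have dM : is_derive t 1
  (fun u => expR (complex.Re a * ln u) * sin (complex.Im a * ln u)) _ :=
  is_deriveM dE dS.
apply: is_derive_eq; rewrite aE ImM (ReM _ (rcpow a t)) (ImM _ (rcpow a t)).
by rewrite ReE ImE /GRing.scale /=; ring.
Qed.

Lemma cvg_rcpow0 (c : R) : 0 < c ->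
  (fun n : nat => expR (c * ln n.+3%:R^-1)) @ \oo --> (0 : R).
Proof.
move=> c0; apply/cvgrPdist_lt => e e0.
(* The threshold is e^(1/c); it is halved because [near_0oo] yields a large inequality where a
   strict one is needed. *)
have d0 : 0 < expR (ln e / c) / 2 :> R by rewrite divr_gt0 ?expR_gt0.
have d1 : expR (ln e / c) / 2 < expR (ln e / c).
  by rewrite ltr_pdivrMr// ltr_pMr ?expR_gt0// ltr1n.
have := near_0oo d0; apply: filterS => n /andP[hn _].
rewrite sub0r normrN ger0_norm ?expR_ge0// -ltr_ln ?posrE ?expR_gt0// expRK.
rewrite mulrC -ltr_pdivlMr// -ltr_expR lnK ?posrE ?invr_gt0//.
exact: le_lt_trans hn d1.
Qed.

(** The derivative [f] of F = t^x (1-t)^y is t^(x-1) (1-t)^(y-1) (x - (x+y) t), that is, x times the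
    kernel at (x, y) minus x+y times the kernel at (x+1, y). As F tends to 0 at both ends, the
    integral of [f] is 0. *)
Lemma cBeta_recursion x y : 0 < complex.Re x -> 0 < complex.Re y ->
  (x + y) * cBeta (x + 1) y = x * cBeta x y.
Proof.
move=> x0 y0.
pose F t := rcpow x t * rcpow y (1 - t).
pose f t := x * rcpow (x - 1) t * rcpow y (1 - t)
  + rcpow x t * - (y * rcpow (y - 1) (1 - t)).
have ixy := cintegrable_beta_kernel x0 y0.
have x10 : 0 < complex.Re (x + 1) by rewrite ReD addr_gt0.
have ix1y := cintegrable_beta_kernel x10 y0.
have fE : {in `]0, 1[%classic, forall t,
    x * beta_kernel x y t + - (x + y) * beta_kernel (x + 1) y t = f t}.
  move=> t /set_mem; rewrite /= in_itv /= => /andP[t0 t1].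
  have t1' : 0 < 1 - t by rewrite subr_gt0.
  rewrite /f /beta_kernel addrK (rcpowS x t0) (rcpowS y t1').
  by rewrite rmorphB /= rmorph1; ring.
have iZ : cintegrable mu `]0, 1[ (fun t => x * beta_kernel x y t).
  exact: (cintegrableZl (mu := mu) (measurable_itv _) _ ixy).
have iZ1 : cintegrable mu `]0, 1[ (fun t => - (x + y) * beta_kernel (x + 1) y t).
  exact: (cintegrableZl (mu := mu) (measurable_itv _) _ ix1y).
have i_f : cintegrable mu `]0, 1[ f.
  apply: (@eq_cintegrable _ _ R mu _ (measurable_itv _) _ _ fE).
  exact: (cintegrableD (mu := mu) (measurable_itv _) iZ iZ1).
suff f0 : cintegral mu `]0, 1[ f = 0.
  apply/esym/eqP; rewrite -subr_eq0 -f0 -(eq_cintegral mu fE).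
  rewrite (cintegralD (mu := mu) (measurable_itv _) iZ iZ1).
  rewrite (cintegralZl (mu := mu) (measurable_itv _) _ ixy).
  by rewrite (cintegralZl (mu := mu) (measurable_itv _) _ ix1y) !cBetaE mulNr.
have dF t : (`]0, 1[%classic : set R) t -> is_cderive F t (f t).
  rewrite /= in_itv /= => /andP[t0 t1].
  have t1' : 0 < 1 - t by rewrite subr_gt0.
  apply: is_cderiveM; first exact: is_cderive_rcpow.
  exact/is_cderive_onem/is_cderive_rcpow.
(* Only the existence of a derivative of [f] matters here: it makes [f] continuous for the
   fundamental theorem. *)
have df t : (`]0, 1[%classic : set R) t -> exists l, is_cderive f t l.
  rewrite /= in_itv /= => /andP[t0 t1].
  have t1' : 0 < 1 - t by rewrite subr_gt0.
  have dc a := is_cderive_rcpow a t0.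
  have dc1 a := is_cderive_onem (is_cderive_rcpow a t1').
  rewrite /f; eexists; apply: is_cderiveD; apply: is_cderiveM.
  - by apply: is_cderiveM; [exact: is_cderive_cst|exact: dc].
  - exact: dc1.
  - exact: dc.
  - under eq_fun do rewrite -mulNr.
    by apply: is_cderiveM; [exact: is_cderive_cst|exact: dc1].
(* Each factor has modulus at most 1, so either one alone bounds F: the first forces F to 0 at the
   left end, the second at the right end. *)
have absF t : 0 < t < 1 -> cabs (F t) <= expR (complex.Re x * ln t) /\
    cabs (F t) <= expR (complex.Re y * ln (1 - t)).
  move=> /andP[t0 t1]; rewrite /F cabsM !cabs_rcpow.
  have le1 (c u : R) : 0 < c -> 0 < u < 1 -> expR (c * ln u) <= 1.
    by move=> c0 u01; rewrite -expR0 ler_expR mulr_ge0_le0 ?ltW// ln_lt0.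
  split; [apply: ler_piMr|apply: ler_piMl]; rewrite ?expR_ge0// le1//.
    by rewrite subr_gt0 t1 ltrBlDr ltrDl.
  by rewrite t0.
have n1 (n : nat) : 0 < (n.+3%:R^-1 : R) < 1.
  by rewrite invr_gt0 invf_lt1 ?ltr1n ?ltr0n.
have n2 (n : nat) : 0 < 1 - (n.+3%:R^-1 : R) < 1.
  by have /andP[h1 h2] := n1 n; rewrite subr_gt0 h2 ltrBlDr ltrDl h1.
have Fa : (fun n : nat => cabs (F n.+3%:R^-1)) @ \oo --> (0 : R).
  apply: (squeeze_cvgr _ (cvg_cst 0) (cvg_rcpow0 x0)).
  by apply: nearW => n; rewrite cabs_ge0 (absF _ (n1 n)).1.
have Fb : (fun n : nat => cabs (F (1 - n.+3%:R^-1))) @ \oo --> (0 : R).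
  apply: (squeeze_cvgr _ (cvg_cst 0) (cvg_rcpow0 y0)).
  apply: nearW => n; rewrite cabs_ge0 (le_trans (absF _ (n2 n)).2)//.
  by rewrite subKr.
have cvg0 (u : nat -> R) (v : nat -> R) : (forall n, `|u n| <= v n) ->
    v @ \oo --> (0 : R) -> u @ \oo --> (0 : R).
  move=> uv v0; apply/norm_cvg0P; apply: (squeeze_cvgr _ (cvg_cst 0) v0).
  by apply: nearW => n; rewrite normr_ge0 uv.
have [ir ii] := i_f.
have vanish := @Rintegral_vanishing_primitive R `]0, 1[ (fun n => n.+3%:R^-1)
  (fun n => 1 - n.+3%:R^-1) (measurable_itv _).
have abD (n : nat) u : n.+3%:R^-1 <= u <= 1 - n.+3%:R^-1 ->
    (`]0, 1[%classic : set R) u.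
  have /andP[h1 h2] := n1 n; move=> /andP[h3 h4]; rewrite /= in_itv /=.
  by rewrite (lt_le_trans h1 h3) (le_lt_trans h4)// ltrBlDr ltrDl.
have Dab (u : R) : (`]0, 1[%classic : set R) u ->
    \forall n \near \oo, (n.+3%:R^-1 : R) <= u <= 1 - n.+3%:R^-1.
  by rewrite /= in_itv /=; exact: near_oo01.
have ab (n : nat) : (n.+3%:R^-1 : R) < 1 - n.+3%:R^-1.
  rewrite ltrBrDr -mulr2n -[_ *+ 2]mulr_natl.
  by rewrite ltr_pdivrMr// mul1r ltr_nat.
apply: complex_eqP; rewrite /=.
- apply: (vanish abD Dab ab _ (fun t => complex.Re (F t))) => //.
  + by move=> t /dF[].
  + by move=> t /df[l [dr _]]; exact: ex_derive.
  + by apply: cvg0 Fa => n; exact: normr_Re_le.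
  + by apply: cvg0 Fb => n; exact: normr_Re_le.
- apply: (vanish abD Dab ab _ (fun t => complex.Im (F t))) => //.
  + by move=> t /dF[].
  + by move=> t /df[l [_ di]]; exact: ex_derive.
  + by apply: cvg0 Fa => n; exact: normr_Im_le.
  + by apply: cvg0 Fb => n; exact: normr_Im_le.
Qed.

End BetaGamma.

(** * The kernel in (p, q, t) and its integral in both orders *)

Section MellinFubini.
Context {R : realType}.
Local Notation mu := (@lebesgue_measure R).
Local Notation mu2 := (product_sfmeasure mu mu).
Local Notation pos := (`]0, +oo[%classic : set R).
Local Notation unit := (`]0, 1[%classic : set R).
Implicit Types (p q t : R) (r s x y : R[i]).

(** The formula u exp(-ln(u^2)) for the inverse is built from measurable functions and is valid at u
    = 0 as well, where both sides are 0. *)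
Lemma measurable_invr (D : set R) : measurable_fun D (fun u : R => u^-1).
Proof.
have -> : (fun u : R => u^-1) = fun u => u * expR (- ln (u ^+ 2)).
  apply/funext => u; have [->|u0] := eqVneq u 0; first by rewrite invr0 mul0r.
  have u20 : 0 < u ^+ 2 by rewrite exprn_even_gt0.
  by rewrite expRN lnK// expr2 invfM mulrA divff// mul1r.
apply: measurable_funM; first exact: measurable_id.
apply: (measurableT_comp (f := @expR R)) => //.
apply: measurable_funN; apply: (measurableT_comp (f := @ln R)).
  exact: measurable_ln.
exact: measurable_funX.
Qed.

Definition mellin_factor r t p : R[i] :=
  (\1_pos p)%:C * (rcpow (r - 1) p * (expR (- (p / t)))%:C).

(** The variables are grouped as ((p, q), t), so that Fubini separates t from the pair. The
    indicators carry the quadrant and the unit interval. *)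
Definition mellin_kernel r s x y (z : (R * R) * R) : R[i] :=
  mellin_factor r z.2 z.1.1 * mellin_factor s (1 - z.2) z.1.2
  * ((\1_unit z.2)%:C * beta_kernel x y z.2).

Lemma cmeasurable_mellin_kernel r s x y :
  cmeasurable setT (mellin_kernel r s x y).
Proof.
have m11 : measurable_fun setT (fun z : (R * R) * R => z.1.1).
  exact: (measurableT_comp (f := @fst R R) measurable_fst measurable_fst).
have m12 : measurable_fun setT (fun z : (R * R) * R => z.1.2).
  exact: (measurableT_comp (f := @snd R R) measurable_snd measurable_fst).
have m2 : measurable_fun setT (fun z : (R * R) * R => z.2).
  exact: measurable_snd.
have m2' : measurable_fun setT (fun z : (R * R) * R => 1 - z.2).
  by apply: measurable_funB => //; exact: measurable_cst.
have mA a (u v : (R * R) * R -> R) : measurable_fun setT u ->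
    measurable_fun setT v ->
    cmeasurable setT (fun z => mellin_factor a (u z) (v z)).
  move=> mu_ mv; apply: cmeasurableM.
    apply: cmeasurable_real; apply: (measurableT_comp (f := \1_pos : R -> R)) mv.
    by apply: measurable_indic; exact: measurable_itv.
  apply: cmeasurableM; first exact: cmeasurable_rcpow.
  apply: cmeasurable_real; apply: (measurableT_comp (f := @expR R)) => //.
  apply: measurable_funN; apply: measurable_funM => //.
  apply: (measurableT_comp (f := fun u : R => u^-1)) mu_; exact: measurable_invr.
apply: cmeasurableM; first by apply: cmeasurableM; exact: mA.
apply: cmeasurableM.
  apply: cmeasurable_real; apply: (measurableT_comp (f := \1_unit : R -> R)) m2.
  by apply: measurable_indic; exact: measurable_itv.
by apply: cmeasurableM; exact: cmeasurable_rcpow.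
Qed.

Section KernelIntegral.
Variables (r s x y : R[i]).
Hypotheses (r0 : 0 < complex.Re r) (s0 : 0 < complex.Re s).
Hypotheses (x0 : 0 < complex.Re x) (y0 : 0 < complex.Re y).

(** The exponents are fresh because the lemma is applied both to [r], [s], for the value, and to
    their real parts, for absolute convergence. *)
Lemma mellin_factor_prod r' s' t : 0 < complex.Re r' -> 0 < complex.Re s' ->
  0 < t < 1 ->
  let f (z : R * R) := mellin_factor r' t z.1 * mellin_factor s' (1 - t) z.2 in
  cintegrable mu2 setT f /\
  cintegral mu2 setT f =
    rcpow r' t * rcpow s' (1 - t) * (cGamma r' * cGamma s').
Proof.
move=> r'0 s'0 /andP[t0 t1] f; have t1' : 0 < 1 - t by rewrite subr_gt0.
have [i1 e1] := cGamma_scale t0 r'0; have [i2 e2] := cGamma_scale t1' s'0.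
have [i3 e3] := cintegral_prod i1 i2.
split; first exact: i3.
by rewrite [LHS]e3 e1 e2; ring.
Qed.

(** Taking moduli only replaces the exponent by its real part, so integrals of moduli are themselves
    Gamma integrals. *)
Lemma cabs_mellin_factor r' t p :
  (cabs (mellin_factor r' t p))%:C = mellin_factor (complex.Re r')%:C t p.
Proof.
rewrite /mellin_factor cabsM cabsM cabs_rcpow !cabs_nneg ?expR_ge0//.
rewrite !rmorphM; congr (_ * (_ * _)).
by rewrite /rcpow -rmorphB -rmorphM /= cexp_real ReB.
Qed.

Lemma integral_cabs_factor_le t : 0 < t < 1 ->
  (\int[mu2]_z (cabs (mellin_factor r t z.1 * mellin_factor s (1 - t) z.2))%:E
  <= (expR (complex.Re r * ln t) * expR (complex.Re s * ln (1 - t)) *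
     cabs (cGamma (complex.Re r)%:C * cGamma (complex.Re s)%:C))%:E)%E.
Proof.
move=> t01.
have [i e] := @mellin_factor_prod (complex.Re r)%:C (complex.Re s)%:C t r0 s0 t01.
have [ir _] := i.
apply: (@le_trans _ _ (integral mu2 setT
    (fun z => (complex.Re (mellin_factor (complex.Re r)%:C t z.1 *
      mellin_factor (complex.Re s)%:C (1 - t) z.2))%:E))).
  rewrite le_eqVlt; apply/orP; left; apply/eqP; apply: eq_integral => z _.
  by rewrite -!cabs_mellin_factor -rmorphM /= cabsM.
rewrite -(fineK (integrable_fin_num measurableT ir)) lee_fin.
have := normr_Re_le (cintegral mu2 setT (fun z => mellin_factor (complex.Re r)%:C t z.1 *
    mellin_factor (complex.Re s)%:C (1 - t) z.2)).
rewrite {2}e cabsM cabsM !cabs_rcpow => /(le_trans (ler_norm _)).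
exact.
Qed.

Lemma beta_kernel_shift t :
  rcpow r t * rcpow s (1 - t) * beta_kernel x y t = beta_kernel (x + r) (y + s) t.
Proof.
rewrite /beta_kernel addrAC [y + s - 1]addrAC !rcpowD; ring.
Qed.

(** Tonelli with (p, q) integrated inside: for fixed t the result is at most [C] times the modulus
    of the beta kernel at (x+r, y+s), which is integrable. *)
Lemma cintegrable_mellin_kernel :
  cintegrable (mu2 \x mu)%E setT (mellin_kernel r s x y).
Proof.
apply: cintegrable_tonelli2; first exact: cmeasurable_mellin_kernel.
pose C := cabs (cGamma (complex.Re r)%:C * cGamma (complex.Re s)%:C).
have xr0 : 0 < complex.Re (x + r) by rewrite ReD addr_gt0.
have ys0 : 0 < complex.Re (y + s) by rewrite ReD addr_gt0.
have ib := (cintegrable_indic mu (measurable_itv _) _).1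
  (cintegrable_beta_kernel xr0 ys0).
have iC := @integrableZl _ _ R mu _ measurableT C _ (cintegrable_cabs measurableT ib).
apply: (le_lt_trans _ (integrable_lty measurableT iC)).
apply: ge0_le_integral => //.
- by move=> t _; apply: integral_ge0 => z _; rewrite lee_fin cabs_ge0.
- have mc := measurable_cabs (cmeasurable_mellin_kernel r s x y).
  have := @measurable_fun_fubini_tonelli_G _ _ _ _ _ mu2
    (fun z => (cabs (mellin_kernel r s x y z))%:E).
  apply; first exact/measurable_EFinP.
  by move=> z; rewrite lee_fin cabs_ge0.
- exact: measurable_int iC.
move=> t _; have [t01|tn01] := boolP (t \in unit); last first.
  rewrite integral0_eq; last first.
    move=> z _; rewrite /mellin_kernel /= indicE (negbTE tn01).
    by rewrite mul0r mulr0 cabs0.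
  by rewrite -EFinM lee_fin mulr_ge0 ?cabs_ge0.
apply: (@le_trans _ _ (integral mu2 setT (fun z => ((cabs (beta_kernel x y t))%:E *
    (cabs (mellin_factor r t z.1 * mellin_factor s (1 - t) z.2))%:E)%E))).
  rewrite le_eqVlt; apply/orP; left; apply/eqP; apply: eq_integral => z _.
  rewrite /mellin_kernel /= indicE t01 mul1r -EFinM.
  by congr EFin; rewrite cabsM mulrC.
have t01' : 0 < t < 1 by move: t01 => /set_mem; rewrite /= in_itv.
have [i _] := mellin_factor_prod r0 s0 t01'.
rewrite ge0_integralZl//; last 3 first.
- by apply: measurable_int; exact: (cintegrable_cabs measurableT i).
- by move=> z _; rewrite lee_fin cabs_ge0.
- by rewrite lee_fin cabs_ge0.
have c0 : (0 <= (cabs (beta_kernel x y t))%:E)%E by rewrite lee_fin cabs_ge0.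
apply: le_trans (lee_wpmul2l c0 (integral_cabs_factor_le t01')) _.
rewrite -!EFinM lee_fin indicE t01 mul1r -beta_kernel_shift.
rewrite (cabsM _ (beta_kernel x y t)) (cabsM (rcpow r t)) !cabs_rcpow -/C.
by rewrite mulrC [C * _]mulrC mulrAC.
Qed.

Lemma cintegral_mellin_kernel :
  cintegral (mu2 \x mu)%E setT (mellin_kernel r s x y) =
  cGamma r * cGamma s * cBeta (x + r) (y + s).
Proof.
have [_ <-] := cfubini2 cintegrable_mellin_kernel.
have xr0 : 0 < complex.Re (x + r) by rewrite ReD addr_gt0.
have ys0 : 0 < complex.Re (y + s) by rewrite ReD addr_gt0.
have ib := (cintegrable_indic mu (measurable_itv _) _).1
  (cintegrable_beta_kernel xr0 ys0).
rewrite cBetaE [in RHS](cintegral_indic mu).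
rewrite -(cintegralZl (mu := mu) measurableT _ ib).
apply: eq_cintegral => t _; have [t01|tn01] := boolP (t \in unit); last first.
  rewrite [in RHS]indicE (negbTE tn01) mul0r mulr0 -[RHS](cintegral0 mu2 setT).
  apply: eq_cintegral => z _; rewrite /mellin_kernel /= indicE (negbTE tn01).
  by rewrite mul0r mulr0.
have t01' : 0 < t < 1 by move: t01 => /set_mem; rewrite /= in_itv.
have [i e] := mellin_factor_prod r0 s0 t01'.
transitivity (cintegral mu2 setT (fun z => beta_kernel x y t *
    (mellin_factor r t z.1 * mellin_factor s (1 - t) z.2))).
  apply: eq_cintegral => z _.
  by rewrite /mellin_kernel /= indicE t01 mul1r mulrC.
rewrite (cintegralZl measurableT _ i) e [in RHS]indicE t01 mul1r.
by rewrite -beta_kernel_shift; ring.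
Qed.

End KernelIntegral.

Lemma cintegrable_ext_beta_kernel p q x y : 0 < p -> 0 < q ->
  0 < complex.Re x -> 0 < complex.Re y ->
  cintegrable mu unit (fun t => beta_kernel x y t *
    (expR (- (p / t) - q / (1 - t)))%:C).
Proof.
move=> p0 q0 x0 y0.
have ib := cintegrable_cabs (mu := mu) (measurable_itv _)
  (cintegrable_beta_kernel x0 y0).
apply: (@cintegrable_le _ _ R mu _ (measurable_itv _) _ _ _ ib).
  apply: cmeasurableM; first exact: cmeasurable_beta_kernel.
  apply: cmeasurable_real; apply: (measurableT_comp (f := @expR R)) => //.
  apply: measurable_funB.
    apply: measurable_funN; apply: measurable_funM; first exact: measurable_cst.
    exact: measurable_invr.
  apply: measurable_funM; first exact: measurable_cst.
  apply: (measurableT_comp (f := fun u : R => u^-1)); first exact: measurable_invr.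
  exact: measurable_onem.
move=> t; rewrite /= in_itv /= => /andP[t0 t1].
rewrite cabsM [cabs (expR _)%:C]cabs_nneg ?expR_ge0//.
rewrite ler_piMr ?cabs_ge0// -[leRHS]expR0 ler_expR.
by rewrite -opprD oppr_le0 addr_ge0// divr_ge0 ?subr_ge0 ?ltW//.
Qed.

Lemma extBetaE p q x y : extBeta p q x y = cintegral mu unit (fun t =>
  beta_kernel x y t * (expR (- (p / t) - q / (1 - t)))%:C).
Proof.
apply: eq_cintegral => t /set_mem; rewrite /= in_itv /= => /andP[t0 t1].
by rewrite !cpow_real// subr_gt0.
Qed.

Lemma mellin_kernel_section r s x y (z : R * R) t :
  mellin_kernel r s x y (z, t) = (\1_unit t)%:C *
    ((\1_(pos `*` pos) z)%:C * (rcpow (r - 1) z.1 * rcpow (s - 1) z.2) *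
     (beta_kernel x y t * (expR (- (z.1 / t) - z.2 / (1 - t)))%:C)).
Proof.
case: z => p q; rewrite /mellin_kernel /mellin_factor /= !indicE.
have -> : ((p, q) \in pos `*` pos) = (p \in pos) && (q \in pos).
  by apply/idP/andP => [/set_mem[/= pp qq]|[/set_mem pp /set_mem qq]];
    [split; exact/mem_set|exact/mem_set].
by case: (p \in pos); case: (q \in pos); rewrite /= expRD rmorphM /=; ring.
Qed.

(** Integrability in t holds at every (p, q), not just almost everywhere as Fubini would give: for
    p, q > 0 the exponential is at most 1, and elsewhere the kernel vanishes. The pointwise bound
    [J_le] relies on this. *)
Lemma mellin_section r s x y (z : R * R) :
  0 < complex.Re x -> 0 < complex.Re y ->
  cintegrable mu setT (fun t => mellin_kernel r s x y (z, t)) /\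
  cintegral mu setT (fun t => mellin_kernel r s x y (z, t)) =
  (\1_(pos `*` pos) z)%:C * (rcpow (r - 1) z.1 * rcpow (s - 1) z.2) *
    extBeta z.1 z.2 x y.
Proof.
move=> x0 y0; case: z => p q.
under eq_fun do rewrite mellin_kernel_section.
have [pq0|pqn0] := boolP ((p, q) \in pos `*` pos); last first.
  have E : (fun t => (\1_unit t)%:C * ((\1_(pos `*` pos) (p, q))%:C *
      (rcpow (r - 1) (p, q).1 * rcpow (s - 1) (p, q).2) * (beta_kernel x y t *
      (expR (- ((p, q).1 / t) - (p, q).2 / (1 - t)))%:C))) = fun=> 0.
    by apply/funext => t; rewrite [\1_(_ `*` _) _]indicE (negbTE pqn0) !mul0r mulr0.
  rewrite E [\1_(_ `*` _) _]indicE (negbTE pqn0) !mul0r; split.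
    exact: cintegrable0.
  exact: cintegral0.
have /set_mem[/= pp qq] := pq0.
have p0 : 0 < p by move: pp; rewrite /= in_itv /= andbT.
have q0 : 0 < q by move: qq; rewrite /= in_itv /= andbT.
have ie := cintegrable_ext_beta_kernel p0 q0 x0 y0.
split.
  apply: (cintegrable_indic mu (measurable_itv _) _).1.
  exact: (cintegrableZl (mu := mu) (measurable_itv _) _ ie).
rewrite extBetaE -(cintegralZl (mu := mu) (measurable_itv _) _ ie).
by rewrite [RHS](cintegral_indic mu).
Qed.

End MellinFubini.

(** * Convergence of complex series, and Pochhammer ratios of beta values *)

Section ComplexSeries.
Context {R : realType}.
Implicit Types (u : nat -> R[i]) (c l z : R[i]).

Definition ccvg u l :=
  (fun n => complex.Re (u n)) @ \oo --> complex.Re l /\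
  (fun n => complex.Im (u n)) @ \oo --> complex.Im l.

Lemma ccvgZ c u l : ccvg u l -> ccvg (fun n => c * u n) (c * l).
Proof.
move=> [ur ui]; split.
  under eq_fun do rewrite ReM.
  by rewrite ReM; apply: cvgB; apply: cvgM => //; exact: cvg_cst.
under eq_fun do rewrite ImM.
by rewrite ImM; apply: cvgD; apply: cvgM => //; exact: cvg_cst.
Qed.

(** Both components converge absolutely by comparison with the exponential series of [e]. *)
Lemma cseries_exp_dominated u (M e : R) : 0 <= e ->
  (forall n, cabs (u n) <= M * (e ^+ n / n`!%:R)) ->
  ccvg (fun n => \sum_(0 <= k < n) u k) (cseries u).
Proof.
move=> e0 uM.
have dom (v : nat -> R) : (forall n, `|v n| <= cabs (u n)) -> cvgn (series v).
  move=> vu; have h0 n : 0 <= M * exp_coeff e n.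
    exact: le_trans (cabs_ge0 _) (uM n).
  have h1 n : `|v n| <= M * exp_coeff e n by exact: le_trans (vu n) (uM n).
  have h2 : cvgn (series (fun n => M * exp_coeff e n)).
    have -> : series (fun n => M * exp_coeff e n) =
        fun n => M * series (exp_coeff e) n.
      by apply/funext => n; rewrite /series /= mulr_sumr.
    exact: (is_cvgM (is_cvg_cst M) (is_cvg_series_exp_coeff e)).
  by apply: normed_cvg; apply: series_le_cvg h2 => // n; exact: normr_ge0.
have cr := dom (fun n => complex.Re (u n)) (fun n => normr_Re_le (u n)).
have ci := dom (fun n => complex.Im (u n)) (fun n => normr_Im_le (u n)).
pose l := limn (series (fun n => complex.Re (u n))) +i*
  limn (series (fun n => complex.Im (u n))).
have hr : (fun n => complex.Re (\sum_(0 <= k < n) u k)) @ \oo --> complex.Re l.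
  by under eq_fun do rewrite Re_sum.
have hi : (fun n => complex.Im (\sum_(0 <= k < n) u k)) @ \oo --> complex.Im l.
  by under eq_fun do rewrite Im_sum.
by rewrite (cseries_lim hr hi).
Qed.

(** Induction with the recursion at a+n; each step may divide by a+d+n, whose real part is
    positive. *)
Lemma cBeta_shift a d n : 0 < complex.Re a -> 0 < complex.Re d ->
  cBeta (a + n%:R) d =
  pochhammer a n / pochhammer (a + d) n * cBeta a d :> R[i].
Proof.
move=> a0 d0; elim: n => [|n IH].
  by rewrite /pochhammer !big_ord0 addr0 divr1 mul1r.
have Ren : complex.Re (n%:R : R[i]) = n%:R.
  by rewrite -(rmorph_nat (real_complex R)).
have an0 : 0 < complex.Re (a + n%:R) by rewrite ReD Ren ltr_pwDl.
have and0 : a + d + n%:R != 0.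
  apply/eqP => /(congr1 (@complex.Re R)) /eqP; rewrite !ReD Ren /=.
  by rewrite gt_eqF// ltr_pwDl// addr_gt0.
have e1 : a + n%:R + 1 = a + n.+1%:R by rewrite -addrA natr1.
have := cBeta_recursion an0 d0; rewrite e1 (addrAC a) IH.
rewrite /pochhammer !big_ord_recr /= -!/(pochhammer _ _) => h.
apply: (mulfI and0); rewrite h invfM.
move: (a + d + n%:R) (a + n%:R) and0 {h e1 an0} => w v w0.
by rewrite -[LHS]mul1r -(divff w0); ring.
Qed.

End ComplexSeries.

(** * Summation over n under the double Mellin integral *)

Section MellinPhi.
Context {R : realType}.
Local Notation mu := (@lebesgue_measure R).
Local Notation mu2 := (product_sfmeasure mu mu).
Local Notation pos := (`]0, +oo[%classic : set R).
Variables (r s b d z c : R[i]).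
Hypotheses (r0 : 0 < complex.Re r) (s0 : 0 < complex.Re s).
Hypotheses (b0 : 0 < complex.Re b) (d0 : 0 < complex.Re d).

(** By [mellin_section] this is p^(r-1) q^(s-1) B_{p,q}(b+n, d), extended by 0 outside the
    quadrant. *)
Let J n (w : R * R) : R[i] :=
  cintegral mu setT (fun t => mellin_kernel r s (b + n%:R) d (w, t)).

Let weight n : R[i] := c / cBeta b d * (z ^+ n / n`!%:R).

Let term n (w : R * R) : R[i] := weight n * J n w.

Let bn0 n : 0 < complex.Re (b + n%:R).
Proof.
rewrite ReD (_ : complex.Re (n%:R : R[i]) = n%:R); first by rewrite ltr_pwDl.
by rewrite -(rmorph_nat (real_complex R)).
Qed.

(** Here t is integrated inside, the order opposite to the one that evaluates the triple
    integral. *)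
Let iJ n : cintegrable mu2 setT (J n) /\
  cintegral mu2 setT (J n) = cGamma r * cGamma s * cBeta (b + r + n%:R) (d + s).
Proof.
have ik := cintegrable_mellin_kernel r0 s0 (bn0 n) d0.
have [i1 e1] := cfubini1 ik.
split; first exact: i1.
by rewrite [LHS]e1 (cintegral_mellin_kernel r0 s0 (bn0 n) d0) (addrAC b).
Qed.

Let iterm n : cintegrable mu2 setT (term n).
Proof. exact: (cintegrableZl measurableT _ (iJ n).1). Qed.

(** The factor 2 is that of [cabs_cintegral_le]. The bound is independent of n, and Fubini makes it
    integrable in (p, q). *)
Let M (w : R * R) : R :=
  2 * Rintegral mu setT (fun t => cabs (mellin_kernel r s b d (w, t))).

Let iM : mu2.-integrable setT (EFin \o M).
Proof.
have ik := cintegrable_cabs measurableT (cintegrable_mellin_kernel r0 s0 b0 d0).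
have [i1 _] := Rintegral_fine (integrable_fubini_F ik).
exact: (integrableZl measurableT 2 i1).
Qed.

Let J_le n (w : R * R) : cabs (J n w) <= M w.
Proof.
have [i1 _] := mellin_section r s w (bn0 n) d0.
have [i2 _] := mellin_section r s w b0 d0.
apply: le_trans (cabs_cintegral_le (mu := mu) measurableT i1) _.
rewrite /M ler_pM2l//; apply: le_Rintegral => //.
- exact: (cintegrable_cabs (mu := mu) measurableT i1).
- exact: (cintegrable_cabs (mu := mu) measurableT i2).
move=> t _; rewrite !mellin_kernel_section indicE.
have [/set_mem|_] := boolP (t \in `]0, 1[%classic); last first.
  by rewrite !mul0r.
rewrite /= in_itv /= => /andP[t0 t1].
rewrite /beta_kernel (addrAC b) (rcpowD (b - 1)) !mul1r.
set e := (expR _)%:C; set k := rcpow (d - 1) _; set g := rcpow (b - 1) t.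
set a := (\1_(_ `*` _) w)%:C * _.
have -> : a * (g * rcpow n%:R t * k * e) = a * (g * k * e) * rcpow n%:R t by ring.
rewrite (cabsM _ (rcpow _ _)) ler_piMr ?cabs_ge0// rcpow_nat//.
by rewrite cabs_nneg ?exprn_ge0 ?exprn_ile1// ltW.
Qed.

Let F (p q : R) : R[i] :=
  cpow p%:C (r - 1) * cpow q%:C (s - 1) * (c * extPhi p q b (b + d) z).

Let f (w : R * R) : R[i] := (\1_(pos `*` pos) w)%:C * F w.1 w.2.

Let term_cvg (w : R * R) : ccvg (fun n => \sum_(0 <= k < n) term k w) (f w).
Proof.
have termE k : term k w = weight k *
    ((\1_(pos `*` pos) w)%:C * (rcpow (r - 1) w.1 * rcpow (s - 1) w.2) *
    extBeta w.1 w.2 (b + k%:R) d).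
  by rewrite /term /J (mellin_section r s w (bn0 k) d0).2.
have [wpos|wn] := boolP (w \in pos `*` pos); last first.
  rewrite /f indicE (negbTE wn) mul0r.
  have -> : (fun n => \sum_(0 <= k < n) term k w) = fun=> 0.
    apply/funext => n; apply: big1 => k _.
    by rewrite termE indicE (negbTE wn) !mul0r mulr0.
  by split; exact: cvg_cst.
have /set_mem[/= pp qq] := wpos.
have p0 : 0 < w.1 by move: pp; rewrite /= in_itv /= andbT.
have q0 : 0 < w.2 by move: qq; rewrite /= in_itv /= andbT.
pose a := rcpow (r - 1) w.1 * rcpow (s - 1) w.2.
have a0 : 0 < cabs a by rewrite /a (cabsM (rcpow _ _)) !cabs_rcpow mulr_gt0 ?expR_gt0.
rewrite /f /F indicE wpos mul1r !cpow_real// -/a mulrA.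
rewrite /extPhi (addrC b) addrK.
set u := (X in cseries X).
have -> : (fun n => \sum_(0 <= k < n) term k w) =
    fun n => a * c * \sum_(0 <= k < n) u k.
  apply/funext => n; rewrite mulr_sumr; apply: eq_bigr => k _.
  by rewrite termE indicE wpos mul1r -/a /u /weight; ring.
(* On the quadrant [J n w] is [a] times the extended beta value and [a] is nonzero, so [J_le] bounds
   that value by [M w / cabs a] for all n. *)
apply: ccvgZ; apply: (@cseries_exp_dominated _ u
  (M w / cabs a * cabs (cBeta b d)^-1) (cabs z)); first exact: cabs_ge0.
move=> n; rewrite /u (cabsM (_ / _)) (cabsM (extBeta _ _ _ _)).
rewrite (cabsM (z ^+ n)) cabsX (cabsV n`!%:R) cabs_nat.
apply: ler_wpM2r; first by rewrite divr_ge0 ?exprn_ge0 ?cabs_ge0.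
apply: ler_wpM2r; first exact: cabs_ge0.
rewrite ler_pdivlMr// mulrC -cabsM; have := J_le n w.
by rewrite /J (mellin_section r s w (bn0 n) d0).2 indicE wpos mul1r -/a.
Qed.

Let sum_le n (w : R * R) : cabs (\sum_(0 <= k < n) term k w) <=
  cabs (c / cBeta b d) * expR (cabs z) * M w.
Proof.
have M0 : 0 <= M w by exact: le_trans (cabs_ge0 _) (J_le 0 w).
apply: le_trans (ler_cabs_sum _ _) _.
have le_term k : cabs (term k w) <=
    cabs (c / cBeta b d) * M w * (cabs z ^+ k / k`!%:R).
  rewrite /term /weight (cabsM (_ * _)) (cabsM (c / _)).
  rewrite (cabsM (z ^+ k)) cabsX (cabsV k`!%:R) cabs_nat mulrAC.
  apply: ler_wpM2r; first by rewrite divr_ge0 ?exprn_ge0 ?cabs_ge0.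
  by apply: ler_wpM2l; [exact: cabs_ge0|exact: J_le].
apply: (@le_trans _ _ (\sum_(0 <= k < n)
    cabs (c / cBeta b d) * M w * (cabs z ^+ k / k`!%:R))).
  by apply: ler_sum => k _; exact: le_term.
rewrite -mulr_sumr [leRHS]mulrAC; apply: ler_wpM2l.
  by apply: mulr_ge0 => //; exact: cabs_ge0.
have nd : nondecreasing_seq (series (exp_coeff (cabs z))).
  apply: nondecreasing_series => k _ _.
  by rewrite /exp_coeff /= divr_ge0 ?exprn_ge0 ?cabs_ge0.
exact: (nondecreasing_cvgn_le nd (is_cvg_series_exp_coeff (cabs z)) n).
Qed.

Let f_lim : cintegrable mu2 setT f /\
  ccvg (fun n => cintegral mu2 setT (fun w => \sum_(0 <= k < n) term k w))
    (cintegral mu2 setT f).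
Proof.
have iD := integrableZl measurableT (cabs (c / cBeta b d) * expR (cabs z)) iM.
have mS n : cmeasurable setT (fun w => \sum_(0 <= k < n) term k w).
  apply: (@cintegrable_measurable _ _ _ mu2).
  by apply: cintegrable_sum => // k; exact: iterm.
have [i1 hr hi] := cdominated_convergence (mu := mu2) measurableT mS
  (fun w _ => (term_cvg w).1) (fun w _ => (term_cvg w).2) iD
  (fun n w _ => sum_le n w).
by split.
Qed.

Let cintegral_f : cintegral mu2 setT f =
  c / cBeta b d * (cGamma r * cGamma s * cBeta (b + r) (d + s)) *
  hyp1F1 (b + r) (b + d + r + s) z.
Proof.
set kappa := c / _ * _; have [_] := f_lim.
have br0 : 0 < complex.Re (b + r) by rewrite ReD addr_gt0.
have ds0 : 0 < complex.Re (d + s) by rewrite ReD addr_gt0.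
pose h n := pochhammer (b + r) n / pochhammer (b + d + r + s) n *
  (z ^+ n / n`!%:R).
have -> : (fun n => cintegral mu2 setT (fun w => \sum_(0 <= k < n) term k w)) =
    fun n => kappa * \sum_(0 <= k < n) h k.
  apply/funext => n; rewrite (cintegral_sum (mu := mu2))//.
  rewrite mulr_sumr; apply: eq_bigr => k _.
  rewrite (cintegralZl measurableT _ (iJ k).1) (iJ k).2.
  rewrite (cBeta_shift k br0 ds0) /weight /kappa /h.
  have -> : b + r + (d + s) = b + d + r + s by ring.
  by ring.
rewrite -[hyp1F1 _ _ _]/(cseries h).
(* If [kappa] is 0, the integrals of the partial sums are all 0 and so is their limit. Otherwise
   dividing by [kappa] shows that the 1F1 series converges and identifies its sum. *)
have [->|kappa0] := eqVneq kappa 0.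
  have -> : (fun n => 0 * \sum_(0 <= k < n) h k) = fun=> 0.
    by apply/funext => n; rewrite mul0r.
  move=> [hr hi]; rewrite mul0r; apply: complex_eqP.
    by apply: (cvg_unique _ hr); [exact: norm_hausdorff|exact: cvg_cst].
  by apply: (cvg_unique _ hi); [exact: norm_hausdorff|exact: cvg_cst].
move=> /(ccvgZ kappa^-1).
have -> : (fun n => kappa^-1 * (kappa * \sum_(0 <= k < n) h k)) =
    fun n => \sum_(0 <= k < n) h k.
  by apply/funext => n; rewrite mulKf.
move=> [hr hi]; rewrite (cseries_lim hr hi).
by rewrite mulVKf.
Qed.

Lemma mellin_extPhi :
  cintegrable (mu \x mu)%E (pos `*` pos) (fun w : R * R => F w.1 w.2) /\
  cintegral mu pos (fun q : R => cintegral mu pos (fun p : R => F p q)) =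
  c / cBeta b d * (cGamma r * cGamma s * cBeta (b + r) (d + s)) *
  hyp1F1 (b + r) (b + d + r + s) z.
Proof.
have [i_f _] := f_lim; split.
  apply: (cintegrable_indic mu2 _ _).2; last exact: i_f.
  by apply: measurableX; exact: measurable_itv.
(* In the iterated integral p is the inner variable, which is the order of [cfubini2]. *)
rewrite -cintegral_f -(cfubini2 i_f).2.
rewrite (cintegral_indic mu); apply: eq_cintegral => q _.
rewrite (cintegral_indic mu).
have [qpos|qn] := boolP (q \in pos).
  rewrite [X in X%:C * _]indicE qpos mul1r; apply: eq_cintegral => p _.
  rewrite /f /= !indicE; congr ((_ : R)%:C * _); congr (_ : bool)%:R.
  by apply/idP/idP => [/set_mem pp|/set_mem[pp _]]; apply/mem_set => //;
    split => //; exact/set_mem.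
rewrite [X in X%:C * _]indicE (negbTE qn) mul0r -[LHS](cintegral0 mu setT).
apply: eq_cintegral => p _; rewrite /f /= indicE.
have /negbTE -> : (p, q) \notin pos `*` pos.
  by apply: contra qn => /set_mem[_ qq]; exact/mem_set.
by rewrite mul0r.
Qed.

End MellinPhi.

Theorem theorem2p3 (R : realType) (lambda rho z r s : R[i])
  (hrho : - 2^-1 < complex.Re rho)
  (hrhoDlambda : - 2^-1 < complex.Re (rho + lambda))
  (hrhoBlambda : - 2^-1 < complex.Re (rho - lambda))
  (hz : ~ (complex.Im z = 0 /\ complex.Re z <= 0))
  (hrs : 0 < Num.min (complex.Re r) (complex.Re s))
  (hDr : - 2^-1 < complex.Re (rho + lambda + r))
  (hBr : - 2^-1 < complex.Re (rho - lambda + r)) :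
  let F (p q : R) : R[i] :=
    cpow p%:C (r - 1) * cpow q%:C (s - 1) * extWhittakerM p q lambda rho z in
  (* the double integral converges absolutely *)
  cintegrable (@lebesgue_measure R \x @lebesgue_measure R)%E
    (`]0, +oo[ `*` `]0, +oo[) (fun pq : R * R => F pq.1 pq.2) /\
  cintegral (@lebesgue_measure R) `]0, +oo[ (fun q : R =>
    cintegral (@lebesgue_measure R) `]0, +oo[ (fun p : R => F p q)) =
  cpow z (rho + 2^-1) * cexp (- (z / 2)) * cGamma r * cGamma s
  * cBeta (rho + r - lambda + 2^-1) (rho + s + lambda + 2^-1)
  / cBeta (rho - lambda + 2^-1) (rho + lambda + 2^-1)
  * hyp1F1 (rho + r - lambda + 2^-1) (2 * rho + r + s + 1) z.
Proof.
move=> F.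
have half : 2^-1 + 2^-1 = 1 :> R[i] by rewrite [RHS]splitr mul1r.
have cE : 2 * rho + 1 = (rho - lambda + 2^-1) + (rho + lambda + 2^-1).
  by rewrite addrACA half; ring.
have Reh : complex.Re (2^-1 : R[i]) = 2^-1.
  by rewrite -(rmorph_nat (real_complex R)) -fmorphV.
have [r0 s0] : 0 < complex.Re r /\ 0 < complex.Re s.
  by move: hrs; rewrite lt_min => /andP[].
have b0 : 0 < complex.Re (rho - lambda + 2^-1) by rewrite ReD Reh; lra.
have d0 : 0 < complex.Re (rho + lambda + 2^-1) by rewrite ReD Reh; lra.
(* The factor z^(rho+1/2) e^(-z/2) is free of p and q and plays the part of the constant [c]; by
   [cE] the second parameter 2 rho + 1 is b + d. *)
have := mellin_extPhi z (cpow z (rho + 2^-1) * cexp (- (z / 2))) r0 s0 b0 d0.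
rewrite -cE => -[i_F e_F]; split; first exact: i_F.
rewrite [LHS]e_F.
have -> : 2 * rho + 1 + r + s = 2 * rho + r + s + 1 by ring.
have -> : rho - lambda + 2^-1 + r = rho + r - lambda + 2^-1 by ring.
have -> : rho + lambda + 2^-1 + s = rho + s + lambda + 2^-1 by ring.
ring.
Qed.
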